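(* Let $r\in\mathbb{N}$ and, for each $N\in\mathbb{N}$, let $A_1,\dots,A_r$ be $r$ independent $N\times N$ GUE random matrices. Then for all $m\in\mathbb{N}$ and all $i=(i_1,\dots,i_m)$ with $i_1,\dots,i_m\in\{1,\dots,r\}$, $$\mathbb{E}\left[\operatorname{tr}(A_{i_1}\cdots A_{i_m})\right]=\sum_{\pi\in\mathcal{P}_2^{[i]}(m)}N^{\#(\gamma\pi)-\frac m2-1},$$ and thus $$\lim_{N\to\infty}\mathbb{E}\left[\operatorname{tr}(A_{i_1}\cdots A_{i_m})\right]=\#\,\mathcal{NC}_2^{[i]}(m).$$
   Context: $\operatorname{tr}=\frac1N\operatorname{Tr}$ is the normalized trace. A standard complex Gaussian is $(X+iY)/\sqrt2$ with $X,Y$ independent standard real Gaussians. An $N\times N$ GUE random matrix is $A=\frac1{\sqrt N}(a_{kl})_{k,l=1}^N$ with $a_{kl}=\overline{a_{lk}}$, $\{a_{kl}\mid k\ge l\}$ independent, and each $a_{kl}$ a standard Gaussian, complex for $k\ne l$ and real for $k=l$. Independence of $A_1,\dots,A_r$ means that the families of entries of the different matrices are independent. A pairing of $[m]=\{1,\dots,m\}$ is a decomposition of $[m]$ into disjoint two-element subsets; $\mathcal{P}_2(m)$ is the set of all pairings (empty for $m$ odd). A pairing $\pi$ is identified with the permutation in $S_m$ that swaps the two elements of each pair. A pairing is non-crossing if there are no pairs $(p,s)$ and $(q,t)$ in $\pi$ with $p<q<s<t$; $\mathcal{NC}_2(m)$ is the set of non-crossing pairings. A pairing $\pi$ respects $i=(i_1,\dots,i_m)$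 if $i_p=i_q$ for all pairs $(p,q)\in\pi$; $\mathcal{P}_2^{[i]}(m)$ and $\mathcal{NC}_2^{[i]}(m)$ denote the sets of all, respectively all non-crossing, pairings of $[m]$ respecting $i$. $\gamma=(1\,2\,\dots\,m)\in S_m$ is the cyclic shift, $\gamma\pi$ is the composition $k\mapsto\gamma(\pi(k))$, and $\#(\gamma\pi)$ is the number of cycles of $\gamma\pi$ (fixed points included). *)

(* Defs.v *)
From HB Require Import structures.
From mathcomp Require Import all_boot all_order all_algebra all_fingroup.

Set Implicit Arguments.
Unset Strict Implicit.
Unset Printing Implicit Defensive.

(* The set [m] = {1, ..., m} is represented by 'I_m = {0, ..., m - 1}. *)

Section Pairings.
Variable m : nat.
Implicit Types (pi : {set {set 'I_m}}) (p q s t : 'I_m).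

Definition pairings : {set {set {set 'I_m}}} :=
  [set pi : {set {set 'I_m}} | partition pi [set: 'I_m] &
    [forall B in pi, #|B| == 2]].

Definition noncrossing pi : bool :=
  [forall p : 'I_m, forall q : 'I_m, forall s : 'I_m, forall t : 'I_m,
    [&& (p < q)%N, (q < s)%N & (s < t)%N] ==>
      ~~ (([set p; s] \in pi) && ([set q; t] \in pi))].

Definition respects r (i : 'I_m -> 'I_r) pi : bool :=
  [forall p : 'I_m, forall q : 'I_m, ([set p; q] \in pi) ==> (i p == i q)].

Definition pairings_resp r (i : 'I_m -> 'I_r) : {set {set {set 'I_m}}} :=
  [set pi in pairings | respects i pi].

Definition nc_pairings_resp r (i : 'I_m -> 'I_r) : {set {set {set 'I_m}}} :=
  [set pi in pairings_resp i | noncrossing pi].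

Definition partner pi p : 'I_m := odflt p [pick q in pblock pi p | q != p].

(* The permutation swapping the two elements of each pair of [pi] (see
   [pairing_permP] below); the default value 1 is only used when [partner pi]
   is not injective, which does not happen for a pairing. *)
Definition pairing_perm pi : 'S_m := insubd (1%g : 'S_m) [ffun p => partner pi p].

Definition cyc_shift : 'S_m := perm (@ordS_inj m).

(* [(s * t)%g] is the permutation k |-> t (s k), so the product below is the
   composition k |-> gamma (pi k); [porbits] is the set of cycles, including
   the fixed points. *)
Definition ncycles_gamma pi : nat :=
  #|porbits (pairing_perm pi * cyc_shift)%g|.

Lemma partnerP pi p q : pi \in pairings -> [set p; q] \in pi ->
  partner pi p = q.
Proof.
rewrite inE => /andP[/and3P[_ tI _] /forall_inP c2] pq.
have npq : p != q by have := c2 _ pq; rewrite cards2; case: (p != q).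
rewrite /partner (def_pblock tI pq) ?set21//.
case: pickP => [s|/(_ q)]; last by rewrite set22 eq_sym npq.
by rewrite !inE => /andP[/orP[/eqP->|/eqP->]]; rewrite ?eqxx.
Qed.

Lemma partner_pair pi p : pi \in pairings -> [set p; partner pi p] \in pi.
Proof.
move=> pip; have := pip; rewrite inE => /andP[/and3P[/eqP cov tI _] /forall_inP c2].
have pc : p \in cover pi by rewrite cov inE.
have Bpi := pblock_mem pc.
have /cards2P[x [y [nxy Bxy]]] := c2 _ Bpi.
have : p \in [set x; y] by rewrite -Bxy mem_pblock.
rewrite Bxy in Bpi; rewrite !inE => /orP[/eqP e|/eqP e]; subst p.
  by rewrite (partnerP pip Bpi).
by rewrite setUC in Bpi; rewrite (partnerP pip Bpi).
Qed.

Lemma pairing_permE pi : pi \in pairings -> pairing_perm pi =1 partner pi.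
Proof.
move=> pip p; rewrite /pairing_perm.
have inj : injectiveb [ffun p => partner pi p].
  apply/injectiveP/(can_inj (g := partner pi)) => q; rewrite ffunE.
  by apply: partnerP => //; rewrite [X in X \in _]setUC; apply: partner_pair.
by rewrite -pvalE val_insubd inj ffunE.
Qed.

Lemma pairing_permP pi p q : pi \in pairings -> [set p; q] \in pi ->
  pairing_perm pi p = q.
Proof. by move=> pip pq; rewrite pairing_permE// (partnerP pip pq). Qed.

End Pairings.

(* Required only here: [classical_sets] redefines [partition], [cover] and
   [trivIset], which are the notions on finite sets in the section above. *)
From mathcomp Require Import complex.
From mathcomp Require Import all_classical all_reals all_analysis.

Import Order.TTheory GRing.Theory Num.Theory.
Import numFieldNormedType.Exports.

Local Open Scope ring_scope.
Local Open Scope classical_set_scope.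

Section Independence.
Context d (T : measurableType d) (R : realType) (P : probability T R).

(* The sigma-algebra on [T] generated by the random variables [Z k]. *)
Definition sigma_family d' (T' : measurableType d') (K : Type)
    (Z : K -> T -> T') : set (set T) :=
  <<s [set E | exists k, preimage_set_system setT (Z k) measurable E] >>.

Definition mutually_independent (I : finType) (D : {set I})
    (F : I -> set (set T)) : Prop :=
  forall (J : {set I}) (E : I -> set T), J \subset D ->
    (forall j, j \in J -> F j (E j)) ->
    P (\big[setI/setT]_(j in J) E j) = (\prod_(j in J) P (E j))%E.

Definition independent_pair (X Y : T -> R) : Prop :=
  forall B C : set R, measurable B -> measurable C ->
    P (X @^-1` B `&` Y @^-1` C) = (P (X @^-1` B) * P (Y @^-1` C))%E.

End Independence.

Section ComplexRandomVariables.
Context d (T : measurableType d) (R : realType) (P : probability T R).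

(* The Borel structure of the complex plane is that of R * R. *)
Definition complex_pair (z : R[i]) : R * R := (complex.Re z, complex.Im z).

Definition complex_integrable (Z : T -> R[i]) : Prop :=
  P.-integrable setT (EFin \o (fun t => complex.Re (Z t))) /\
  P.-integrable setT (EFin \o (fun t => complex.Im (Z t))).

Definition complex_expectation (Z : T -> R[i]) : R[i] :=
  (fine 'E_P[fun t => complex.Re (Z t)] +i*
   fine 'E_P[fun t => complex.Im (Z t)])%C.

Definition std_normal_RV (X : {RV P >-> R}) : Prop :=
  forall B : set R, measurable B -> distribution P X B = normal_prob 0 1 B.

Definition std_real_gaussian (Z : T -> R[i]) : Prop :=
  exists2 X : {RV P >-> R}, std_normal_RV X & forall t, Z t = (X t)%:C%C.

Definition std_complex_gaussian (Z : T -> R[i]) : Prop :=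
  exists X Y : {RV P >-> R},
    [/\ std_normal_RV X, std_normal_RV Y, independent_pair P X Y &
        forall t, Z t = (X t +i* Y t)%C / (Num.sqrt 2)%:C%C].

End ComplexRandomVariables.

Section GUE.
Context d (T : measurableType d) (R : realType) (P : probability T R).

Definition is_GUE N (A : T -> 'M[R[i]]_N) : Prop :=
  exists a : 'I_N -> 'I_N -> T -> R[i],
  [/\ forall t, A t = ((Num.sqrt N%:R)^-1)%:C%C *: \matrix_(k, l) a k l t,
      forall k l t, a k l t = conjc (a l k t),
      mutually_independent P
        [set kl : 'I_N * 'I_N | (kl.2 <= kl.1)%N]%SET
        (fun kl => sigma_family
          (fun _ : unit => @complex_pair R \o a kl.1 kl.2)),
      forall k l, k != l -> std_complex_gaussian P (a k l) &
      forall k, std_real_gaussian P (a k k)].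

Definition independent_matrices N r (A : 'I_r -> T -> 'M[R[i]]_N) : Prop :=
  mutually_independent P [set: 'I_r]%SET
    (fun j => sigma_family
      (fun (kl : 'I_N * 'I_N) (t : T) => complex_pair (A j t kl.1 kl.2))).

End GUE.

Definition normalized_trace (R : realType) N (M : 'M[R[i]]_N) : R[i] :=
  N%:R^-1 * \tr M.

(* Main.v *)
Require Import Defs.
From HB Require Import structures.
From mathcomp Require Import all_boot all_order all_algebra all_fingroup.

(** Why the formula holds. The entries of independent GUE matrices are complex
    linear combinations of finitely many independent standard real Gaussians
    ([entry_coord], [coord_std_normal], [coord_independent]), and the covariance of
    two entries, E(a_kl^(j) a_k'l'^(j')) without any conjugation, is 1 when j = j',
    k = l' and l = k', and 0 otherwise ([gue_coef_covariance]). Expanding the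
    trace over index functions f : 'I_m -> 'I_N turns its expectation into a sum
    of expectations of products of m entries, and Wick's formula rewrites each of
    them as a sum over pairings of products of covariances.

    Wick's formula is obtained here in three steps. Independence and Fubini's
    theorem factor the expectation of a monomial in the coordinates into moments
    ([normal_monomial_expectation]). The moments obey M (n + 2) = (n + 1) M n,
    because the derivative of x^(n+1) exp(-x^2/2) has integral 0
    ([normal_moment_rec]); this recursion is the one satisfied by the number of
    pairings whose blocks join equal coordinates ([wick_monomial]). Multilinearity
    then passes from coordinates to entries ([wick_linear_forms]); it amounts to
    choosing a coordinate once per block instead of once per point
    ([sum_constant_on_blocks]).

    If pi does not respect i, some covariance is 0. If it does, the covariances are all 1 exactly when f is
    invariant under gamma pi, that is, constant on its cycles; so there are
    N^#(gamma pi) such f ([sum_fixed_functions]), and the normalizations 1/N and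
    N^(-1/2) of the trace and of the m matrices give the exponent.

    For the limit, gamma pi is reached from gamma, which has one cycle, by
    multiplying with the m/2 transpositions of pi, one at a time. Each of them
    either splits a cycle or merges two, so #(gamma pi) <= m/2 + 1, with equality
    if and only if all of them split. For a non-crossing pairing the two ends of a
    pair always lie in the same cycle ([noncrossing_same_cycle]); if two pairs
    cross, starting with them produces a merge ([ncycles_gamma_crossing]). Hence
    exactly the non-crossing pairings contribute 1 in the limit and all the others
    contribute 0. *)

Set Implicit Arguments.
Unset Strict Implicit.
Unset Printing Implicit Defensive.

Import Order.TTheory GRing.Theory Num.Theory.

Local Open Scope ring_scope.

(** * Pairings of a finite set *)

Section PairPartitions.
Variable I : finType.
Implicit Types (S B : {set I}) (pi : {set {set I}}) (p q : I).

(** Defined for subsets, so that what remains after the removal of a pair is again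
    a pairing of the same kind. *)
Definition pair_partitions S : {set {set {set I}}} :=
  [set pi : {set {set I}} | partition pi S & [forall B in pi, #|B| == 2]].

Definition mate pi p : I := odflt p [pick q | (q != p) && ([set p; q] \in pi)].

Lemma pair_partitionsP S pi : reflect
  [/\ cover pi = S, trivIset pi & forall B, B \in pi -> #|B| = 2]
  (pi \in pair_partitions S).
Proof.
rewrite inE; apply: (iffP andP).
  by move=> [/and3P[/eqP ? ? _] /forall_inP c2]; split=> // B /c2 /eqP.
move=> [cov tI c2]; split; last by apply/forall_inP => B /c2 ->.
apply/and3P; split=> //; first exact/eqP.
by apply/negP => /c2; rewrite cards0.
Qed.

Lemma card2_pair B p : #|B| = 2 -> p \in B -> exists2 q, q != p & B = [set p; q].
Proof.
move=> /eqP /cards2P[x [y [nxy ->]]]; rewrite !inE => /orP[] /eqP ->.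
  by exists y => //; rewrite eq_sym.
by exists x => //; rewrite setUC.
Qed.

Lemma pair_inj p q s : q != p -> s != p -> [set p; q] = [set p; s] -> q = s.
Proof.
move=> qp sp e; have : q \in [set p; s] by rewrite -e set22.
by rewrite !inE (negPf qp) => /eqP.
Qed.

Lemma mate_eq S pi p q : pi \in pair_partitions S -> q != p ->
  [set p; q] \in pi -> mate pi p = q.
Proof.
move=> /pair_partitionsP[_ tI _] qp Bpi; rewrite /mate.
case: pickP => [s /andP[sp Bs]|/(_ q)]; last by rewrite qp Bpi.
apply: (pair_inj (p := p)) => //.
by rewrite -(def_pblock tI Bpi (set21 _ _)) -(def_pblock tI Bs (set21 _ _)).
Qed.

Lemma mate_pair S pi p : pi \in pair_partitions S -> p \in S ->
  (mate pi p != p) /\ [set p; mate pi p] \in pi.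
Proof.
move=> pip pS; have /pair_partitionsP[cov tI c2] := pip.
have pc : p \in cover pi by rewrite cov.
have Bpi := pblock_mem pc.
have [q qp Bq] := card2_pair (c2 _ Bpi) (etrans (mem_pblock _ _) pc).
rewrite Bq in Bpi.
by rewrite (mate_eq pip qp Bpi).
Qed.

Lemma pair_partitions0 : pair_partitions set0 = [set set0].
Proof.
apply/setP => pi; rewrite in_set1; apply/pair_partitionsP/eqP => [[cov _ c2]|->].
  apply/setP => B; rewrite inE; apply/negP => Bpi.
  have : B \subset set0 by rewrite -cov; apply: (bigcup_sup B).
  by rewrite subset0 => /eqP B0; move: (c2 _ Bpi); rewrite B0 cards0.
split=> [||B]; rewrite ?inE //; first by rewrite /cover big_set0.
by apply/trivIsetP => B; rewrite inE.
Qed.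

Lemma pair_partitions_add S pi p q : p \in S -> q \in S -> q != p ->
  pi \in pair_partitions (S :\ p :\ q) ->
  [set p; q] \notin pi /\ [set p; q] |: pi \in pair_partitions S.
Proof.
move=> pS qS qp /pair_partitionsP[cov tI c2].
have pn : p \notin cover pi by rewrite cov !inE eqxx /= andbF.
have nin : [set p; q] \notin pi.
  apply/negP => Bpi; case/negP: pn; apply/bigcupP.
  by exists [set p; q] => //; rewrite set21.
split=> //; apply/pair_partitionsP; split.
- rewrite /cover big_setU1 //= -/(cover pi) cov; apply/setP => x; rewrite !inE.
  by case: (x =P p) => [->|_]; rewrite ?pS //; case: (x =P q) => [->|_].
- rewrite /trivIset /cover !big_setU1 //= -/(cover pi) cov.
  move/eqP: tI => ->; rewrite cov [X in _ == X]cardsU.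
  rewrite (_ : _ :&: _ = set0) ?cards0 ?subn0 ?eqxx //.
  by apply/setP => x; rewrite !inE; case: (x == p); case: (x == q).
- move=> B; rewrite !inE => /orP[/eqP->|/c2 //].
  by rewrite cards2 eq_sym qp.
Qed.

Lemma pair_partitions_del S pi p q : q != p -> [set p; q] \in pi ->
  pi \in pair_partitions S -> pi :\ [set p; q] \in pair_partitions (S :\ p :\ q).
Proof.
move=> qp Bpi /pair_partitionsP[cov tI c2]; apply/pair_partitionsP; split.
- apply/setP => x; rewrite -cov !inE; apply/bigcupP/and3P.
    move=> [B]; rewrite !inE => /andP[Bn Bp] xB; split; last by apply/bigcupP; exists B.
      apply: contraNneq Bn => xq; rewrite xq in xB.
      by rewrite -(def_pblock tI Bpi (set22 _ _)) (def_pblock tI Bp xB).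
    apply: contraNneq Bn => xq; rewrite xq in xB.
    by rewrite -(def_pblock tI Bpi (set21 _ _)) (def_pblock tI Bp xB).
  move=> [xq xp /bigcupP[B Bp xB]]; exists B => //; rewrite !inE Bp andbT.
  apply: contraTneq xB => ->; rewrite !inE negb_or.
  by rewrite xq xp.
- by apply: trivIsetS tI; rewrite subD1set.
- by move=> B; rewrite !inE => /andP[_ /c2].
Qed.

(** A pairing of [S] is the choice of the mate [q] of [p] together with a pairing
    of the remaining points. *)
Lemma sum_pair_partitions_rec (C : comPzSemiRingType) (w : {set I} -> C) S p :
  p \in S ->
  \sum_(pi in pair_partitions S) \prod_(B in pi) w B =
  \sum_(q in S :\ p) w [set p; q] *
    \sum_(pi in pair_partitions (S :\ p :\ q)) \prod_(B in pi) w B.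
Proof.
move=> pS; rewrite (partition_big (mate^~ p) (mem (S :\ p))) /=; last first.
  move=> pi pip; have [mp Bpi] := mate_pair pip pS.
  rewrite !inE mp /=; have /pair_partitionsP[<- _ _] := pip.
  by apply/bigcupP; exists [set p; mate pi p]; rewrite ?set22.
apply: eq_bigr => q; rewrite !inE => /andP[qp qS]; rewrite big_distrr /=.
rewrite (reindex_onto (fun pi => [set p; q] |: pi) (fun pi => pi :\ [set p; q])) /=.
  apply: eq_big => pi.
    apply/idP/idP.
      move=> /andP[/andP[a /eqP mq] /eqP e]; rewrite -e.
      by apply: pair_partitions_del => //; rewrite setU11.
    move=> /(pair_partitions_add pS qS qp)[nin a].
    by rewrite a setU1K // eqxx andbT /= (mate_eq a qp) // setU11.
  move=> /andP[/andP[a /eqP mq] /eqP e].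
  by rewrite big_setU1 //= -e setD11.
move=> pi /andP[pip /eqP mq]; rewrite setD1K // -mq.
by have [] := mate_pair pip pS.
Qed.

End PairPartitions.

Section Exchange.
Variables (I V : finType) (v0 : V) (C : comPzSemiRingType).

(** Expanding the product of sums picks one value per block, and such a choice is
    the same as a function that is constant on every block. *)
Lemma sum_constant_on_blocks (pi : {set {set I}}) (c : I -> V -> C) :
  partition pi [set: I] ->
  \sum_(v : {ffun I -> V})
     (\prod_p c p (v p)) *
     \prod_(B in pi) ([forall p in B, forall q in B, v p == v q])%:R =
  \prod_(B in pi) \sum_(w : V) \prod_(p in B) c p w.
Proof.
move=> /and3P[/eqP cov tI n0].
have inc p : p \in cover pi by rewrite cov inE.
pose rep (B : {set I}) := [pick p in B].
have repP B : B \in pi -> exists2 p, rep B = Some p & p \in B.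
  move=> Bpi; rewrite /rep; case: pickP => [p pB|B0]; first by exists p.
  case/negP: n0; suff -> : set0 = B by [].
  by apply/setP => x; rewrite inE B0.
rewrite (big_distr_big_dep v0) /=.
pose bc (v : {ffun I -> V}) := [forall B in pi, [forall p in B, forall q in B, v p == v q]].
rewrite (bigID bc) /= [X in _ + X]big1 ?addr0; last first.
  move=> v; rewrite negb_forall_in => /exists_inP[B Bpi nB].
  by rewrite (bigD1 B) //= (negPf nB) mul0r mulr0.
(* [F] spreads a value per block over the block, [G] reads it off at a
   representative; outside [pi] the expansion has the default value [v0]. *)
pose F (h : {ffun {set I} -> V}) := [ffun p => h (pblock pi p)].
pose G (v : {ffun I -> V}) := [ffun B => if B \in pi then oapp v v0 (rep B) else v0].
have FG v : bc v -> F (G v) = v.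
  move=> /forall_inP bcv; apply/ffunP => p; rewrite !ffunE pblock_mem //.
  have [x -> xB] := repP _ (pblock_mem (inc p)).
  have /forall_inP/(_ _ xB)/forall_inP := bcv _ (pblock_mem (inc p)).
  by move=> /(_ p); rewrite mem_pblock => /(_ (inc p)) /eqP.
rewrite (reindex_onto F G) //=.
apply: eq_big => h.
  apply/andP/pfamilyP.
    move=> [bch /eqP e]; split=> // ; apply/supportP => B nB.
    by rewrite -e ffunE (negPf nB).
  move=> [/supportP sh _]; split.
    apply/forall_inP => B Bpi; apply/forall_inP => p pB; apply/forall_inP => q qB.
    by rewrite !ffunE (def_pblock tI Bpi pB) (def_pblock tI Bpi qB).
  apply/eqP/ffunP => B; rewrite !ffunE.
  case: ifPn => [Bpi|/sh -> //].
  have [x -> xB] := repP _ Bpi.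
  by rewrite /= ffunE (def_pblock tI Bpi xB).
move=> /andP[/forall_inP bch _].
rewrite [X in _ * X]big1 ?mulr1; last by move=> B Bpi; rewrite bch.
under eq_bigr do rewrite ffunE.
rewrite (eq_bigl (fun x => x \in cover pi)); last by move=> x; rewrite inc.
rewrite big_trivIset //=; apply: eq_bigr => B Bpi; apply: eq_bigr => p pB.
by rewrite (def_pblock tI Bpi pB).
Qed.

End Exchange.

(** * Wick's formula as an algebraic identity *)

Section Wick.
Variables (I V : finType) (C : comPzSemiRingType) (M : nat -> C).
Hypotheses (M0 : M 0 = 1) (M1 : M 1 = 0)
           (Mrec : forall n, M n.+2 = n.+1%:R * M n).

(** With [M n] the number of pairings of [n] points, both sides count the pairings
    of [S] that join only points with equal [v]. The proof removes a point [p]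
    on both sides: the recursion of [M] says that the fibre of [p] offers
    [#|N1|] choices for its mate, all leaving the same product. *)
Lemma wick_monomial (v : I -> V) (S : {set I}) :
  \prod_(w : V) M #|[set p in S | v p == w]| =
  \sum_(pi in pair_partitions S)
    \prod_(B in pi) ([forall p in B, forall q in B, v p == v q])%:R.
Proof.
have [n] := ubnP #|S|; elim: n => // n IHn in S *; rewrite ltnS => Sn.
have [->|[p pS]] := set_0Vmem S.
  rewrite pair_partitions0 big_set1 big_set0 big1 // => w _.
  by rewrite (_ : [set _ in _ | _] = set0) ?cards0 //; apply/setP => x; rewrite !inE andFb.
rewrite (sum_pair_partitions_rec _ pS).
under [RHS]eq_bigr => q qS.
  move: (qS); rewrite !inE => /andP[qp qS'].
  have lt : (#|S :\ p :\ q| < n)%N.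
    rewrite (leq_trans _ Sn) // [X in (_ < X)%N](cardsD1 p) pS.
    by rewrite (cardsD1 q (S :\ p)) qS add1n add1n.
  rewrite -(IHn _ lt).
  rewrite (_ : [forall _ in _, _] = (v p == v q)); last first.
    apply/forall_inP/eqP => [/(_ p (set21 _ _))/forall_inP/(_ q (set22 _ _))/eqP //|e].
    move=> x; rewrite !inE => /orP[] /eqP->; apply/forall_inP => y;
    by rewrite !inE => /orP[] /eqP->; rewrite ?e.
  over.
rewrite (bigID (fun q => v p == v q)) /= [X in _ + X]big1 ?addr0; last first.
  by move=> q /andP[_ /negPf ->]; rewrite mul0r.
rewrite (bigD1 (v p)) //=.
set N0 := [set q in S | v q == v p].
have pN : p \in N0 by rewrite inE pS eqxx.
set K := \prod_(w | w != v p) _.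
(* the possible mates of [p] *)
pose N1 := N0 :\ p.
have cN : #|N0| = #|N1|.+1 by rewrite (cardsD1 p) pN.
rewrite (eq_bigr (fun _ => M #|N1|.-1 * K)); last first.
  move=> q /andP[]; rewrite !inE => /andP[qp qS] vq; rewrite vq mul1r.
  rewrite (bigD1 (v p)) //=; congr (M _ * _).
    rewrite (cardsD1 q N1) !inE qp qS eq_sym vq /=.
    apply: eq_card => x; rewrite !inE.
    by case: (x == q); case: (x == p); case: (x \in S); case: (v x == v p).
  apply: eq_bigr => w wp; congr M.
  have vpw : (v p == w) = false by rewrite eq_sym; apply: negPf.
  apply: eq_card => x; rewrite !inE.
  case: (eqVneq x q) => [->|]; first by rewrite -(eqP vq) vpw !andbF.
  by case: (eqVneq x p) => [->|//]; rewrite vpw !andbF.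
rewrite sumr_const.
rewrite [X in _ *+ X](_ : _ = #|N1|); last first.
  apply: eq_card => x; rewrite [LHS]unfold_in !inE [v p == _]eq_sym.
  by case: (x == p); case: (x \in S).
rewrite cN; case: (#|N1|) => [|k] /=; first by rewrite M1 mul0r mulr0n.
by rewrite Mrec -[in RHS]mulr_natl mulrA.
Qed.

End Wick.

(** The left side is the expectation of the product over [p] of the linear forms
    with coefficients [c p], expanded into monomials of independent variables with
    moments [M]; on the right, each block contributes a covariance. *)
Lemma wick_linear_forms (I V : finType) (C : comPzSemiRingType) (M : nat -> C)
    (v0 : V) (c : I -> V -> C) :
  M 0 = 1 -> M 1 = 0 -> (forall n, M n.+2 = n.+1%:R * M n) ->
  \sum_(v : {ffun I -> V})
     (\prod_p c p (v p)) * \prod_(w : V) M #|[set p | v p == w]| =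
  \sum_(pi in pair_partitions [set: I])
    \prod_(B in pi) \sum_(w : V) \prod_(p in B) c p w.
Proof.
move=> M0 M1 Mrec.
under [RHS]eq_bigr => pi pip.
  rewrite -(sum_constant_on_blocks v0); last by move: pip; rewrite inE => /andP[].
  over.
rewrite exchange_big /=; apply: eq_bigr => v _; rewrite -big_distrr /=; congr (_ * _).
rewrite -(wick_monomial M0 M1 Mrec); apply: eq_bigr => w _; congr M.
by apply: eq_card => x; rewrite !inE.
Qed.

(** * Functions constant on the cycles of a permutation *)

Section FixedFunctions.
Variables (I V : finType) (v0 : V) (s : {perm I}).

Lemma partition_porbits : partition (porbits s) [set: I].
Proof.
apply/and3P; split.
- apply/eqP/setP => x; rewrite inE; apply/bigcupP.
  by exists (porbit s x); rewrite ?porbit_id //; apply: imset_f.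
- apply/trivIsetP => _ _ /imsetP[x _ ->] /imsetP[y _ ->]; apply: contraR.
  move=> /pred0Pn[z /andP[/= zx zy]].
  by rewrite -!eq_porbit_mem in zx zy; rewrite -(eqP zx) -(eqP zy).
- apply/imsetP => -[x _ e]; have := porbit_id s x.
  by rewrite -e inE.
Qed.

Lemma constant_on_porbits (v : I -> V) :
  [forall x, v (s x) == v x] =
  [forall B in porbits s, forall x in B, forall y in B, v x == v y].
Proof.
apply/forallP/forall_inP => [vs _ /imsetP[x _ ->]|vB x].
  have vX n y : v ((s ^+ n)%g y) = v y.
    by elim: n => [|n IH]; rewrite ?expg0 ?perm1 // expgSr permM (eqP (vs _)).
  apply/forall_inP => _ /porbitP[i ->]; apply/forall_inP => _ /porbitP[j ->].
  by rewrite !vX.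
have /vB/forall_inP/(_ (s x)) : porbit s x \in porbits s by apply: imset_f.
have sx : s x \in porbit s x by apply: (mem_porbit s 1).
by move=> /(_ sx)/forall_inP/(_ _ (porbit_id s x)).
Qed.

(** This is [sum_constant_on_blocks] for the partition into cycles and constant
    weights. *)
Lemma sum_fixed_functions (C : comPzSemiRingType) :
  \sum_(v : {ffun I -> V}) [forall x, v (s x) == v x]%:R
  = (#|V| ^ #|porbits s|)%:R :> C.
Proof.
have e := sum_constant_on_blocks v0 (fun _ _ => 1 : C) partition_porbits.
rewrite [RHS](eq_bigr (fun _ => #|V|%:R)) in e; last first.
  move=> B _; transitivity (\sum_(w : V) (1 : C)); last by rewrite sumr_const.
  by apply: eq_bigr => w _; rewrite big1.
rewrite [RHS]prodr_const -natrX in e; rewrite -e; apply: eq_bigr => v _.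
rewrite big1 // mul1r constant_on_porbits.
case: forall_inP => [vB|/forall_inP].
  by rewrite big1 // => B /vB ->.
rewrite negb_forall_in => /exists_inP[B Bs nB].
by rewrite (bigD1 B) //= (negPf nB) mul0r.
Qed.

End FixedFunctions.

(** * Cycles of gamma pi and crossings *)

Section Orbits.
Variables (I : finType) (s : {perm I}) (O : {set I}).

(** The orbit of [p] enters [O], has to come back to [p] outside [O], and can leave
    [O] only through [q]. *)
Lemma porbit_exit p q : p \notin O -> s p \in O ->
  (forall x, x \in O -> x != q -> s x \in O) -> q \in porbit s p.
Proof.
move=> pO spO sO; apply: contraNT pO => nq.
have sX n : (s ^+ n.+1)%g p \in O.
  elim: n => [|n IH]; first by rewrite expg1.
  rewrite expgSr permM sO //; apply: contraNneq nq => <-; exact: mem_porbit.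
by rewrite -[p in p \in _]perm1 -(expg_order s) -(prednK (order_gt0 s)).
Qed.

Lemma porbit_closed p q : (forall x, x \in O -> s x \in O) -> p \in O ->
  q \notin O -> q \notin porbit s p.
Proof.
move=> sO pO; apply: contraNN => /porbitP[n ->].
by elim: n => [|n IH]; rewrite ?expg0 ?perm1 // expgSr permM sO.
Qed.

End Orbits.

Section Swaps.
Variable I : finType.
Implicit Types (S B : {set I}) (pi : {set {set I}}) (l : seq {set I}).

Definition swap B : {perm I} :=
  if enum B is [:: a; b] then tperm a b else 1%g.

Lemma swapE x y : x != y -> swap [set x; y] = tperm x y.
Proof.
move=> nxy; rewrite /swap.
have : perm_eq (enum [set x; y]) [:: x; y].
  apply: uniq_perm; first exact: enum_uniq.
    by rewrite /= inE nxy.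
  by move=> z; rewrite mem_enum !inE.
case: (enum _) => [/perm_size //|a [/perm_size //|b [|c l' /perm_size //]]] e.
have ax : a \in [:: x; y] by rewrite -(perm_mem e) mem_head.
have bx : b \in [:: x; y] by rewrite -(perm_mem e) !inE eqxx orbT.
have : a != b by have := perm_uniq e; rewrite /= !inE nxy => /andP[].
by move: ax bx; rewrite !inE => /orP[] /eqP-> /orP[] /eqP->; rewrite ?eqxx // tpermC.
Qed.

Definition swaps l : {perm I} := (\prod_(B <- l) swap B)%g.

(** A product of the transpositions of some blocks of [pi] depends only on the set
    of these blocks; in particular they may be multiplied in any order. *)
Lemma swapsE S pi l : pi \in pair_partitions S -> uniq l -> {subset l <= pi} ->
  forall x, x \in S -> swaps l x = if pblock pi x \in l then mate pi x else x.
Proof.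
move=> pip; have /pair_partitionsP[cov tI c2] := pip.
elim: l => [|B l IH] /=; first by move=> _ _ x _; rewrite /swaps big_nil perm1.
move=> /andP[Bl ul] sub x xS; rewrite /swaps big_cons permM -/(swaps l).
have {}IH := IH ul (fun C Cl => sub C (mem_behead (s := B :: l) Cl)).
have Bpi : B \in pi by rewrite sub ?mem_head.
have [xB|xB] := boolP (x \in B).
  have [y yx eB] := card2_pair (c2 _ Bpi) xB.
  have yS : y \in S by rewrite -cov; apply/bigcupP; exists B => //; rewrite eB set22.
  rewrite (def_pblock tI Bpi xB) inE eqxx /= eB swapE 1?eq_sym // tpermL.
  rewrite IH // (def_pblock tI Bpi) ?(negPf Bl) ?eB ?set22 //.
  by rewrite (mate_eq pip yx) // -eB.
have Bx : pblock pi x != B.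
  by apply: contraNneq xB => <-; rewrite mem_pblock cov.
rewrite inE (negPf Bx) /= -IH //; congr (swaps l _).
have /cards2P[a [b [nab eB]]] : #|B| == 2 by rewrite c2.
move: xB; rewrite eB !inE negb_or swapE // => /andP[xa xb].
by rewrite tpermD // eq_sym.
Qed.

Lemma swaps_enum S pi : pi \in pair_partitions S ->
  forall x, x \in S -> swaps (enum pi) x = mate pi x.
Proof.
move=> pip x xS; have /pair_partitionsP[cov _ _] := pip.
rewrite (swapsE pip (enum_uniq _)) //; last by move=> B; rewrite mem_enum.
by rewrite mem_enum pblock_mem // cov.
Qed.

Lemma porbits_swap_ub B (s : {perm I}) :
  (#|porbits (swap B * s)%g| <= #|porbits s|.+1)%N.
Proof.
rewrite /swap; case: (enum B) => [|a [|b [|c l]]]; rewrite ?mul1g //.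
have := porbits_mul_tperm s a b; rewrite /= => e.
apply: (leq_trans (leq_addr (a \notin porbit s b).*2 _)); rewrite e -addn1 leq_add2l.
exact: leq_b1.
Qed.

Lemma porbits_swaps_ub l (s : {perm I}) :
  (#|porbits (swaps l * s)%g| <= size l + #|porbits s|)%N.
Proof.
elim: l => [|B l IH] /=; first by rewrite /swaps big_nil mul1g.
rewrite /swaps big_cons -mulgA; apply: leq_trans (porbits_swap_ub _ _) _.
by rewrite addSn ltnS.
Qed.

Lemma porbits_tperm_split (s : {perm I}) x y : x != y -> y \in porbit s x ->
  #|porbits (tperm x y * s)%g| = #|porbits s|.+1.
Proof.
move=> nxy yx; have := porbits_mul_tperm s x y.
by rewrite /= porbit_sym yx addn0 nxy addn1.
Qed.

Lemma porbits_tperm_merge (s : {perm I}) x y : x != y -> y \notin porbit s x ->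
  (#|porbits (tperm x y * s)%g| < #|porbits s|)%N.
Proof.
move=> nxy yx; have := porbits_mul_tperm s x y.
by rewrite /= porbit_sym yx nxy addn2 addn1 => -[<-].
Qed.

End Swaps.

Section Genus.
Variable m : nat.
Hypothesis m_gt0 : (0 < m)%N.
Local Notation gamma := (cyc_shift m).
Implicit Types (p q x y : 'I_m) (l : seq {set 'I_m}).

Lemma pairingsE : pairings m = pair_partitions [set: 'I_m].
Proof. by []. Qed.

Lemma cyc_shiftS p : (p.+1 < m)%N -> gamma p = p.+1 :> nat.
Proof. by move=> pm; rewrite permE /= modn_small. Qed.

Lemma porbits_cyc_shift : #|porbits gamma| = 1%N.
Proof.
pose o : 'I_m := Ordinal m_gt0.
have or x : x \in porbit gamma o.
  case: x => k km; elim: k => [|k IH] in km *.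
    by rewrite (_ : Ordinal km = o) ?porbit_id //; apply: val_inj.
  have := IH (ltnW km); rewrite -eq_porbit_mem => /eqP <-.
  rewrite (_ : Ordinal km = (gamma ^+ 1)%g (Ordinal (ltnW km))) ?mem_porbit //.
  by apply: val_inj; rewrite expg1 /= cyc_shiftS.
apply/eqP/cards1P; exists (porbit gamma o); apply/setP => B; rewrite inE.
apply/imsetP/eqP => [[x _ ->]|->]; last by exists o.
by apply/eqP; rewrite eq_porbit_mem or.
Qed.

Variable pi : {set {set 'I_m}}.
Hypothesis pi_pairing : pi \in pairings m.

Let pip : pi \in pair_partitions [set: 'I_m]. Proof. by rewrite -pairingsE. Qed.

Lemma pairing_perm_swaps : pairing_perm pi = swaps (enum pi).
Proof.
apply/permP => x; rewrite (swaps_enum pip) ?inE //; apply: pairing_permP => //.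
by have [] := mate_pair pip (in_setT x).
Qed.

Lemma card_pairing : m = #|pi|.*2.
Proof.
have := card_partition (P := pi) (D := [set: 'I_m]).
move: (pi_pairing); rewrite inE => /andP[-> /forall_inP c2] /(_ isT).
rewrite cardsT card_ord (eq_bigr (fun _ => 2%N)); last by move=> B /c2 /eqP.
by rewrite sum_nat_const muln2.
Qed.

Lemma ncycles_gamma_ub : (ncycles_gamma pi <= #|pi|.+1)%N.
Proof.
rewrite /ncycles_gamma pairing_perm_swaps.
by rewrite (leq_trans (porbits_swaps_ub _ _)) // porbits_cyc_shift addn1 cardE.
Qed.

Lemma pair_uniq p q q' : [set p; q] \in pi -> [set p; q'] \in pi -> q = q'.
Proof. by move=> /(partnerP pi_pairing) <- /(partnerP pi_pairing) <-. Qed.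

(** The set [p < x <= q] is entered right after [p], and every block other than
    [{p, q}] stays inside or outside of it because it does not cross [{p, q}]; so
    [porbit_exit] applies. This is why every transposition of a non-crossing
    pairing splits a cycle, whatever the order. *)
Lemma noncrossing_same_cycle l p q :
  noncrossing pi -> uniq l -> {subset l <= pi} -> (p < q)%N ->
  [set p; q] \in pi -> [set p; q] \notin l ->
  q \in porbit (swaps l * gamma)%g p.
Proof.
move=> nc ul sub pq Bpi Bl.
have /pair_partitionsP[cov tI c2] := pip.
have ncP (a b c d : 'I_m) : (a < b)%N -> (b < c)%N -> (c < d)%N ->
    [set a; c] \in pi -> [set b; d] \in pi -> false.
  move=> ab bc cd h1 h2; have /forallP/(_ a)/forallP/(_ b)/forallP/(_ c)/forallP/(_ d) := nc.
  by rewrite ab bc cd h1 h2.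
have sE := swapsE pip ul sub.
apply: (@porbit_exit _ _ [set x : 'I_m | (p < x)%N && (x <= q)%N]).
- by rewrite inE ltnn.
- rewrite permM sE ?inE // (def_pblock tI Bpi (set21 _ _)) (negPf Bl).
  by rewrite cyc_shiftS ?ltnSn ?pq // (leq_ltn_trans pq).
move=> x; rewrite inE => /andP[px xq] nxq.
have {xq nxq} xq : (x < q)%N by rewrite ltn_neqAle nxq.
suff /andP[py yq] : (p < swaps l x)%N && (swaps l x < q)%N.
  rewrite inE permM cyc_shiftS; first by rewrite ltnS ltnW ?ltnS.
  by rewrite (leq_ltn_trans yq).
rewrite sE ?inE //; case: ifP => _; last by rewrite px xq.
have [yx] := mate_pair pip (in_setT x).
set y := mate pi x in yx * => Byx.
have yp : y != p.
  apply: contraTneq xq => e; rewrite e setUC in Byx.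
  by rewrite (pair_uniq Byx Bpi) ltnn.
have yq : y != q.
  apply: contraTneq px => e; rewrite e setUC in Byx; rewrite setUC in Bpi.
  by rewrite (pair_uniq Byx Bpi) ltnn.
apply/andP; split; rewrite ltnNge; apply/negP; rewrite leq_eqVlt => /orP[].
- by rewrite (inj_eq val_inj) (negPf yp).
- by move=> lt; rewrite setUC in Byx; have := ncP _ _ _ _ lt px xq Byx Bpi.
- by rewrite (inj_eq val_inj) eq_sym (negPf yq).
- by move=> lt; have := ncP _ _ _ _ px xq lt Bpi Byx.
Qed.

Lemma noncrossing_swaps l : noncrossing pi -> uniq l -> {subset l <= pi} ->
  #|porbits (swaps l * gamma)%g| = (size l).+1.
Proof.
move=> nc; elim: l => [|B l IH] /=.
  by rewrite /swaps big_nil mul1g porbits_cyc_shift.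
move=> /andP[Bl ul] sub.
have sub' : {subset l <= pi} by move=> C Cl; rewrite sub // inE Cl orbT.
have Bpi : B \in pi by rewrite sub ?mem_head.
have /pair_partitionsP[_ _ c2] := pip.
have [x [y [xy eB]]] : exists x y, (x < y)%N /\ B = [set x; y].
  have /cards2P[x [y [nxy eB]]] : #|B| == 2 by rewrite c2.
  case: (ltngtP x y) => h; first by exists x, y.
    by exists y, x; rewrite setUC.
  by rewrite (val_inj h) eqxx in nxy.
have nxy : x != y by apply: contraTneq xy => ->; rewrite ltnn.
rewrite /swaps big_cons -mulgA -/(swaps l) eB swapE //.
by rewrite porbits_tperm_split ?IH //; apply: noncrossing_same_cycle; rewrite -?eB.
Qed.

(** For crossing pairs [{p, s}] and [{q, t}], the transposition of [p] and [s]
    splits the cycle gamma in two, with [q] and [t] on different sides, so the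
    transposition of [q] and [t] merges again. *)
Lemma ncycles_gamma_crossing : ~~ noncrossing pi -> (ncycles_gamma pi < #|pi|.+1)%N.
Proof.
rewrite negb_forall => /existsP[p]; rewrite negb_forall => /existsP[q].
rewrite negb_forall => /existsP[s]; rewrite negb_forall => /existsP[t].
rewrite negb_imply negbK => /andP[/and3P[pq qs st] /andP[B1 B2]].
have nps : p != s by apply: contraTneq (ltn_trans pq qs) => ->; rewrite ltnn.
have nqt : q != t by apply: contraTneq (ltn_trans qs st) => ->; rewrite ltnn.
have n12 : [set q; t] != [set p; s].
  apply/eqP => e; have : t \in [set p; s] by rewrite -e set22.
  rewrite !inE => /orP[] /eqP e'; move: st; rewrite e' ?ltnn // ltnNge.
  by rewrite ltnW // (ltn_trans pq).
pose rest := pi :\ [set p; s] :\ [set q; t].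
(* The last factors of [swaps l] act first on gamma, so the crossing pairs come
   at the end. *)
pose l := enum rest ++ [:: [set q; t]; [set p; s]].
have pl : perm_eq (enum pi) l.
  apply: uniq_perm; first exact: enum_uniq.
    rewrite cat_uniq enum_uniq /= orbF inE n12 !mem_enum !inE !eqxx /= andbF.
    by [].
  move=> B; rewrite mem_enum mem_cat mem_enum !inE.
  case: (eqVneq B [set q; t]) => [->|_]; first by rewrite B2.
  by case: (eqVneq B [set p; s]) => [->|_]; rewrite ?B1 ?orbF.
have ul : uniq l by rewrite -(perm_uniq pl) enum_uniq.
have sub : {subset l <= pi} by move=> B; rewrite -(perm_mem pl) mem_enum.
rewrite /ncycles_gamma (_ : pairing_perm pi = swaps l); last first.
  rewrite pairing_perm_swaps; apply/permP => x.
  rewrite (swapsE pip (enum_uniq _)) ?inE //; last by move=> B; rewrite mem_enum.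
  by rewrite (swapsE pip ul) ?inE // (perm_mem pl).
have gs : (#|porbits (tperm p s * gamma)%g| <= 2)%N.
  by rewrite -(swapE nps) (leq_trans (porbits_swap_ub _ _)) // porbits_cyc_shift.
(* [p < x <= s] is one of the two cycles after the first transposition. *)
have tq : t \notin porbit (tperm p s * gamma)%g q.
  apply: (@porbit_closed _ _ [set x : 'I_m | (p < x)%N && (x <= s)%N]).
  - move=> x; rewrite !inE permM => /andP[px xs].
    have [->|nxs] := eqVneq x s.
      rewrite tpermR cyc_shiftS ?ltnSn /= ?(ltn_trans pq) //.
      by rewrite (leq_ltn_trans _ (ltn_ord s)) // (ltn_trans pq).
    have {}xs : (x < s)%N by rewrite ltn_neqAle nxs.
    rewrite tpermD; last by rewrite eq_sym.
      by rewrite cyc_shiftS ?xs ?andbT ?ltnS ?(ltnW px) // (leq_ltn_trans xs).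
    by apply: contraTneq px => ->; rewrite ltnn.
  - by rewrite inE pq ltnW.
  - by rewrite inE negb_and -!ltnNge st orbT.
rewrite /swaps big_cat /= -mulgA big_cons big_seq1 !swapE // -mulgA.
rewrite (leq_ltn_trans (porbits_swaps_ub _ _)) //.
have -> : #|pi| = (size (enum rest) + 2)%N.
  by rewrite cardE (perm_size pl) size_cat.
by rewrite ltnS leq_add2l ltnW // (leq_trans (porbits_tperm_merge nqt tq)).
Qed.

Lemma ncycles_gamma_noncrossing :
  (ncycles_gamma pi == #|pi|.+1) = noncrossing pi.
Proof.
apply/idP/idP => [e|nc]; first by apply: contraTT e => /ncycles_gamma_crossing; case: ltngtP.
rewrite /ncycles_gamma pairing_perm_swaps noncrossing_swaps ?enum_uniq //.
  by rewrite cardE.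
by move=> B; rewrite mem_enum.
Qed.

End Genus.

(* Imported only from here on: [classical_sets] redefines [partition], [cover]
   and [trivIset], which are the notions on finite sets in the parts above. *)
From mathcomp Require Import complex.
From mathcomp Require Import all_classical all_reals all_analysis.
From mathcomp Require Import measurable_realfun ring lra.

Import numFieldNormedType.Exports.

Local Open Scope classical_set_scope.

(** * Moments of the standard normal law *)

Section NormalMoments.
Variable R : realType.
Notation mu := (@lebesgue_measure R).
Implicit Types (x : R) (n : nat).

Let w x : R := expR (- x ^+ 2 / 2).

(** From [|x| <= exp |x|] and [n |x| <= n^2 + x^2/4]: the bounding function is
    Gaussian with variance 2, hence integrable. *)
Lemma power_gauss_le n x : `|x ^+ n * expR (- x ^+ 2 / 2)| <=
  expR (n%:R ^+ 2) * normal_fun 0 (Num.sqrt 2) x.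
Proof.
rewrite /normal_fun subr0 sqr_sqrtr ?ler0n // normrM normrX.
rewrite [X in _ * X]ger0_norm ?expR_ge0 //.
have h : `|x| ^+ n <= expR (n%:R * `|x|).
  rewrite expRM_natl lerXn2r ?nnegrE ?expR_ge0 //.
  by apply: le_trans (expR_ge1Dx _); rewrite lerDr ler01.
apply: (le_trans (ler_wpM2r (expR_ge0 _) h)).
rewrite -!expRD ler_expR -[x ^+ 2]real_normK ?num_real //.
set y := `|x|; have := sqr_ge0 (n%:R - y / 2).
nra.
Qed.

Lemma measurable_power_gauss n : measurable_fun [set: R] (fun x => x ^+ n * w x).
Proof.
apply: measurable_funM; first exact: measurable_funX.
apply: measurableT_comp => //; apply: measurable_funM => //.
by apply: measurableT_comp => //; apply: measurable_funX.
Qed.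

Lemma integrable_power_gauss n :
  mu.-integrable [set: R] (EFin \o (fun x => x ^+ n * w x)).
Proof.
have s0 : Num.sqrt 2 != 0 :> R by rewrite sqrtr_eq0 -ltNge ltr0n.
have p0 := lt0r_neq0 (normal_peak_gt0 s0).
apply: (@le_integrable _ _ _ mu _ measurableT _
  (fun x => (expR (n%:R ^+ 2) / normal_peak (Num.sqrt 2))%:E *
            (normal_pdf 0 (Num.sqrt 2) x)%:E)%E).
- by apply/measurable_EFinP; exact: measurable_power_gauss.
- move=> x _; rewrite /= lee_fin (le_trans (power_gauss_le n x)) //.
  rewrite normal_pdfE // ger0_norm; last first.
    by rewrite !mulr_ge0 ?invr_ge0 ?expR_ge0 ?normal_peak_ge0 ?normal_fun_ge0.
  by rewrite mulrA divfK ?lexx.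
- by apply: integrableZl => //; apply: integrable_normal_pdf.
Qed.


Let df n x := (n%:R * x ^+ n.-1 - x ^+ n.+1) * w x.

Lemma is_derive_power_gauss n x :
  is_derive x 1 (fun x : R => x ^+ n * w x) (df n x).
Proof.
have dX : is_derive x 1 (fun x : R => x ^+ n) (n%:R * x ^+ n.-1).
  apply: DeriveDef; first exact: exprn_derivable.
  by rewrite exp_derive /GRing.scale /= mulr1.
have dw : is_derive x 1 w (- x * w x).
  rewrite /w.
  have h : is_derive x 1 (fun x : R => - x ^+ 2 / 2) (- x).
    apply: is_derive_eq.
    by rewrite /GRing.scale /=; field.
  apply: is_derive_eq.
  by rewrite mulrC.
apply: is_derive_eq.
by rewrite /df /GRing.scale /= exprS; ring.
Qed.

Lemma continuous_power_gauss n : continuous (fun x : R => x ^+ n * w x).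
Proof.
move=> x; apply: differentiable_continuous; apply/derivable1_diffP.
by have [] := is_derive_power_gauss n x.
Qed.

(** One more power of [x] is still bounded, which gives the decay at infinity. *)
Lemma power_gauss_bound n x :
  `|x ^+ n * w x| * `|x| <= expR (n.+1%:R ^+ 2).
Proof.
rewrite mulrC normrM mulrA -normrM -exprS -normrM.
apply: (le_trans (power_gauss_le _ _)).
rewrite ler_piMr ?expR_ge0 // /normal_fun -[leRHS]expR0 ler_expR.
by rewrite mulNr oppr_le0 divr_ge0 ?sqr_ge0 // mulrn_wge0 ?sqr_ge0.
Qed.

Lemma cvg_power_gauss n (e : nat -> R) : (forall k, `|e k| = k.+1%:R) ->
  (e k ^+ n * w (e k)) @[k --> \oo] --> (0 : R).
Proof.
move=> ek; apply: norm_cvg0.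
apply: (@squeeze_cvgr _ _ _ _ (fun=> 0) (fun k => expR (n.+1%:R ^+ 2) * harmonic k)).
- near=> k; rewrite normr_ge0 /= /harmonic ler_pdivlMr ?ltr0n //.
  by rewrite -(ek k) power_gauss_bound.
- exact: cvg_cst.
- rewrite -[X in _ --> X](mulr0 (expR (n.+1%:R ^+ 2))).
  by apply: cvgM; [exact: cvg_cst|exact: cvg_harmonic].
Unshelve. all: end_near. Qed.

Lemma continuous_derive_power_gauss n : continuous (df n).
Proof.
have -> : df n = (fun x => n%:R * (x ^+ n.-1 * w x) - x ^+ n.+1 * w x).
  by apply/funext => x; rewrite /df mulrBl mulrA.
move=> x; apply: (@cvgB _ R^o); last exact: continuous_power_gauss.
by apply: cvgM; [exact: cvg_cst|exact: continuous_power_gauss].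
Qed.

Lemma integrable_derive_power_gauss n : mu.-integrable [set: R] (EFin \o df n).
Proof.
have -> : EFin \o df n = (fun x => (n%:R * (x ^+ n.-1 * w x))%:E - (x ^+ n.+1 * w x)%:E)%E.
  by apply/funext => x; rewrite /df /= -EFinB mulrBl mulrA.
apply: integrableB => //; last exact: integrable_power_gauss.
under eq_fun do rewrite EFinM.
by apply: integrableZl => //; exact: integrable_power_gauss.
Qed.

(** Integration by parts in disguise: on the intervals [[-(k+1), k+1]] the integral
    of the derivative is a difference of boundary values, which tend to 0. *)
Lemma integral_derive_power_gauss n : (\int[mu]_x (df n x)%:E = 0)%E.
Proof.
pose I k : set R := `[- k.+1%:R, k.+1%:R]%classic.
have Ik k : (\int[mu]_(x in I k) (df n x)%:E =
    (k.+1%:R ^+ n * w k.+1%:R - (- k.+1%:R) ^+ n * w (- k.+1%:R))%:E)%E.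
  rewrite (@continuous_FTC2 _ (df n) (fun x => x ^+ n * w x)) //.
  - by rewrite gtrN ?ltr0n.
  - by apply: continuous_subspaceT; apply: continuous_derive_power_gauss.
  - have cF := @continuous_power_gauss n; split.
    + by move=> x _; have [] := is_derive_power_gauss n x.
    + by apply: cvg_at_right_filter; apply: cF.
    + by apply: cvg_at_left_filter; apply: cF.
  - by move=> x _; rewrite derive1E; have [_ ->] := is_derive_power_gauss n x.
have mdf : measurable_fun setT (EFin \o df n).
  by have /integrableP[] := integrable_derive_power_gauss n.
have mI k : measurable (I k) by exact: measurable_itv.
have [|||||] := @dominated_convergence _ _ _ mu setT measurableT
  (fun k => (EFin \o df n) \_ (I k)) (EFin \o df n) (fun x => `|(EFin \o df n) x|%E).
- move=> k; apply: ((measurable_restrictT _ (mI k)).1 _).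
  by apply: measurable_funTS; exact: mdf.
- exact: mdf.
- apply: aeW => x _; apply: cvg_near_cst.
  near=> k; rewrite patchE mem_set // /I /= in_itv /= -ler_norml.
  apply: (@le_trans _ _ k%:R); last by rewrite ler_nat.
  by near: k; exact: nbhs_infty_ger.
- exact: integrable_abse (integrable_derive_power_gauss n).
- apply: aeW => x k _; rewrite patchE; case: ifP => _ //.
  by rewrite abse0 abse_ge0.
move=> _ _ h; have : (0 = \int[mu]_x (EFin \o df n) x)%E; last by move=> <-.
apply: (cvg_unique _ _ h) => //.
rewrite (_ : (fun k => _) = (fun k => (k.+1%:R ^+ n * w k.+1%:R -
    (- k.+1%:R) ^+ n * w (- k.+1%:R))%:E)); last first.
  by apply/funext => k; rewrite -Ik [RHS]integral_mkcond.
apply: cvg_EFin; first by near=> k.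
rewrite -[0]subr0; apply: (@cvgB _ R^o).
  by apply: cvg_power_gauss => k; rewrite normr_nat.
by apply: cvg_power_gauss => k; rewrite normrN normr_nat.
Unshelve. all: end_near.
Qed.


Notation nu := (normal_prob (0 : R) 1).

Lemma normal_pdf01 x : normal_pdf 0 1 x = normal_peak 1 * w x.
Proof.
by rewrite normal_pdfE ?oner_eq0 // /normal_fun /w subr0 expr1n.
Qed.

Let ae_density : ae_eq mu setT
  (Radon_Nikodym (charge_of_finite_measure nu) mu) (fun x => (normal_pdf 0 1 x)%:E).
Proof.
have dom := @normal_prob_dominates R 0 1.
apply: integral_ae_eq => //.
- exact: Radon_Nikodym_integrable.
- by apply/measurable_EFinP; exact: measurable_normal_pdf.
- by move=> E _ mE; rewrite -Radon_Nikodym_integral.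
Qed.

(** The nonnegative case comes first: it is what shows that powers are integrable,
    before [integral_std_normal] can be applied to them. *)
Lemma ge0_integral_std_normal (f : R -> \bar R) :
  measurable_fun [set: R] f -> (forall x, 0 <= f x)%E ->
  (\int[nu]_x f x = \int[mu]_x (f x * (normal_pdf 0 1 x)%:E))%E.
Proof.
move=> mf f0; have dom := @normal_prob_dominates R 0 1.
rewrite -(Radon_Nikodym_SigmaFinite.change_of_variables dom) //.
apply: ae_eq_integral => //.
- apply: emeasurable_funM => //; apply: (measurable_int mu).
  exact: Radon_Nikodym_SigmaFinite.f_integrable.
- by apply: emeasurable_funM => //; apply/measurable_EFinP; exact: measurable_normal_pdf.
- apply: ae_eqe_mul2l; apply: ae_eq_trans ae_density.
  exact: ae_eq_Radon_Nikodym_SigmaFinite.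
Qed.

Lemma integral_std_normal (f : R -> \bar R) : nu.-integrable [set: R] f ->
  (\int[nu]_x f x = \int[mu]_x (f x * (normal_pdf 0 1 x)%:E))%E.
Proof.
move=> fi; have dom := @normal_prob_dominates R 0 1.
have mf : measurable_fun [set: R] f by have /integrableP[] := fi.
rewrite -(Radon_Nikodym_change_of_variables dom) //.
apply: ae_eq_integral => //.
- exact: emeasurable_funM.
- by apply: emeasurable_funM => //; apply/measurable_EFinP; exact: measurable_normal_pdf.
- by apply: ae_eqe_mul2l; apply: ae_density.
Qed.

Lemma integrable_std_normal_power n : nu.-integrable [set: R] (fun x => (x ^+ n)%:E).
Proof.
have mX : measurable_fun [set: R] (fun x : R => (x ^+ n)%:E).
  by apply/measurable_EFinP; exact: measurable_funX.
apply/integrableP; split=> //.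
rewrite ge0_integral_std_normal //; last exact: measurableT_comp.
have /integrableP[_] := integrableZl measurableT (normal_peak 1) (integrable_power_gauss n).
apply: le_lt_trans; rewrite le_eqVlt; apply/orP; left; apply/eqP.
apply: eq_integral => x _ /=.
rewrite normal_pdf01 -!EFinM; congr (_%:E).
rewrite [RHS]normrM (ger0_norm (normal_peak_ge0 _)) normrM (ger0_norm (expR_ge0 _)).
by rewrite mulrCA.
Qed.

Definition normal_moment n : R := fine (\int[nu]_x (x ^+ n)%:E).

Lemma normal_momentE n :
  normal_moment n = normal_peak 1 * fine (\int[mu]_x (x ^+ n * w x)%:E).
Proof.
rewrite /normal_moment integral_std_normal; last exact: integrable_std_normal_power.
have ig := integrable_power_gauss n.
rewrite (_ : normal_peak 1 = fine (normal_peak 1)%:E) // -fineM //; last first.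
  by apply: integrable_fin_num.
rewrite -integralZl //; congr fine; apply: eq_integral => x _.
by rewrite normal_pdf01 -!EFinM mulrCA.
Qed.

Lemma normal_moment0 : normal_moment 0 = 1.
Proof.
rewrite /normal_moment; under eq_integral do rewrite expr0.
rewrite integral_cst // mul1e.
by have /(congr1 fine) := @probability_setT _ _ _ (normal_prob (0 : R) 1).
Qed.

Let moment_rec n :
  n%:R * fine (\int[mu]_x (x ^+ n.-1 * w x)%:E) = fine (\int[mu]_x (x ^+ n.+1 * w x)%:E).
Proof.
have i1 := integrable_power_gauss n.-1; have i2 := integrable_power_gauss n.+1.
have := integral_derive_power_gauss n.
rewrite (_ : (fun x => (df n x)%:E) = (fun x =>
    n%:R%:E * (x ^+ n.-1 * w x)%:E - (x ^+ n.+1 * w x)%:E)%E); last first.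
  by apply/funext => x; rewrite /df -EFinM -EFinB mulrBl mulrA.
rewrite integralB //; last exact: integrableZl.
rewrite integralZl // => /(congr1 fine).
rewrite fineB ?fin_numM ?(integrable_fin_num _ i1) ?(integrable_fin_num _ i2) //.
by rewrite fineM ?(integrable_fin_num _ i1) // => /eqP; rewrite subr_eq0 => /eqP.
Qed.

Lemma normal_moment1 : normal_moment 1 = 0.
Proof. by rewrite normal_momentE -(moment_rec 0) mul0r mulr0. Qed.

(** Stein's identity for the standard normal law, on monomials. *)
Lemma normal_moment_rec n : normal_moment n.+2 = n.+1%:R * normal_moment n.
Proof. by rewrite !normal_momentE -(moment_rec n.+1) mulrCA. Qed.

End NormalMoments.

(** * Products of independent random variables *)

Section IndependentFamily.
Context d (T : measurableType d) (R : realType) (P : probability T R).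

(** By independence the joint law of [(X, Y)] agrees with the product of the laws on
    rectangles, hence everywhere, and Fubini's theorem applies. *)
Lemma independent_pair_expectation (X Y : T -> R) :
  measurable_fun setT X -> measurable_fun setT Y -> independent_pair P X Y ->
  P.-integrable setT (EFin \o X) -> P.-integrable setT (EFin \o Y) ->
  P.-integrable setT (EFin \o (X \* Y)) /\
  (\int[P]_t (X t * Y t)%:E = \int[P]_t (X t)%:E * \int[P]_t (Y t)%:E)%E.
Proof.
move=> mX mY ind iX iY.
pose X' : {mfun T >-> R} := HB.pack X (isMeasurableFun.Build _ _ _ _ X mX).
pose Y' : {mfun T >-> R} := HB.pack Y (isMeasurableFun.Build _ _ _ _ Y mY).
pose Z t := (X t, Y t).
have mZ : measurable_fun setT Z by exact: measurable_fun_pair.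
pose Z' : {mfun T >-> (R * R)%type} := HB.pack Z (isMeasurableFun.Build _ _ _ _ Z mZ).
pose m1 := distribution P X'; pose m2 := distribution P Y'.
have law D : measurable D -> (m1 \x m2)%E D = distribution P Z' D.
  move=> mD; apply: product_measure_unique; last exact: mD.
  by move=> A B mA mB; exact: (ind A B mA mB).
pose h (p : R * R) : \bar R := (p.1 * p.2)%:E.
have mh : measurable_fun setT h.
  apply/measurable_EFinP; apply: measurable_funM.
    exact: measurable_fst.
  exact: measurable_snd.
have iabsX : (\int[P]_t `|(X t)%:E| < +oo)%E by have /integrableP[] := iX.
have iabsY : (\int[P]_t `|(Y t)%:E| < +oo)%E by have /integrableP[] := iY.
have mabs : measurable_fun [set: R] (fun x : R => `|x%:E|%E).
  by apply: measurableT_comp => //.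
have int12 : (m1 \x m2)%E.-integrable setT h.
  apply/integrable12ltyP => //.
  have -> : (\int[m1]_x \int[m2]_y `|h (x, y)| =
             \int[m1]_x (`|x%:E| * \int[m2]_y `|y%:E|))%E.
    apply: eq_integral => x _; rewrite -ge0_integralZl //.
    by apply: eq_integral => y _; rewrite /h /= -EFinM normrM.
  rewrite ge0_integralZr //; last by apply: integral_ge0.
  rewrite !ge0_integral_distribution //.
  apply: lte_mul_pinfty; [by apply: integral_ge0 => t _; exact: abse_ge0| |exact: iabsY].
  by rewrite ge0_fin_numE; [exact: iabsX|apply: integral_ge0 => t _; exact: abse_ge0].
have intZ : P.-integrable setT (h \o Z').
  apply/integrableP; split; first exact: measurableT_comp.
  have mah : measurable_fun setT (abse \o h) by exact: measurableT_comp.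
  rewrite -(ge0_integral_distribution Z' mah); last by move=> y; exact: abse_ge0.
  rewrite (eq_measure_integral (m1 \x m2)%E) => [|D mD _]; last by apply/esym; exact: law.
  by have /integrableP[] := int12.
split=> //.
have -> : (\int[P]_t (X t * Y t)%:E = \int[m1 \x m2]_p h p)%E.
  rewrite -(integral_distribution mh intZ).
  by apply: eq_measure_integral => D mD _; apply/esym; exact: law.
have iY' : m2.-integrable setT (fun y : R => y%:E).
  apply/integrableP; split; first exact/measurable_EFinP.
  by rewrite ge0_integral_distribution.
have iX' : m1.-integrable setT (fun x : R => x%:E).
  apply/integrableP; split; first exact/measurable_EFinP.
  by rewrite ge0_integral_distribution.
have eY : (\int[m2]_y y%:E = \int[P]_t (Y t)%:E)%E.
  by rewrite integral_distribution //; exact/measurable_EFinP.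
have eX : (\int[m1]_y y%:E = \int[P]_t (X t)%:E)%E.
  by rewrite integral_distribution //; exact/measurable_EFinP.
have fY : (\int[m2]_y y%:E)%E \is a fin_num by apply: integrable_fin_num.
rewrite -integral12_prod_meas1 // -eY -eX.
rewrite -(fineK fY) -integralZr //; apply: eq_integral => x _.
by rewrite fineK // -integralZl.
Qed.

Variables (V : finType) (X : V -> T -> R).

(** The product rule for the whole index set contains the one for each subfamily:
    take [B v = setT] for the other indices. *)
Definition independent_family : Prop := forall B : V -> set R,
  (forall v, measurable (B v)) ->
  P (\big[setI/setT]_v (X v @^-1` B v)) = (\prod_v P (X v @^-1` B v))%E.

Hypothesis mX : forall v, measurable_fun setT (X v).
Hypothesis indX : independent_family.

Let cylinders (s : seq V) : set (set T) := [set E | exists B : V -> set R,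
  [/\ forall w, measurable (B w), forall w, w \notin s -> B w = setT &
      E = \big[setI/setT]_w (X w @^-1` B w)]].

(** For a fixed event [A] of [X v], the measures [E |-> P (E & A)] and
    [E |-> P A * P E] agree on the cylinders over [s], which are stable under
    intersection, hence on the sigma-algebra that they generate; the product over
    [s] is measurable for the latter. *)
Lemma independent_prod v (s : seq V) : v \notin s ->
  independent_pair P (X v) (fun t => \prod_(w <- s) X w t).
Proof.
move=> vs B0 C mB0 mC.
pose A := X v @^-1` B0.
have mXB w B : measurable B -> measurable (X w @^-1` B).
  by move=> mB; rewrite -[X in measurable X]setTI; exact: mX.
have mA : measurable A by exact: mXB.
pose p : {nonneg R} := NngNum (fine_ge0 (measure_ge0 P A)).
have pE : (p%:num)%:E = P A by rewrite /= fineK // fin_num_measure.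
suff H E : <<s cylinders s >> E -> mrestr P mA E = mscale p P E.
  rewrite setIC.
  have := H ((fun t => \prod_(w <- s) X w t) @^-1` C).
  rewrite /mrestr /mscale /= pE; apply.
  pose T' := g_sigma_algebraType (cylinders s).
  have mf : measurable_fun (setT : set T') (fun t : T' => \prod_(w <- s) X w t).
    apply: measurable_prod => w ws _ B mB; rewrite setTI.
    apply: sub_sigma_algebra.
    exists (fun u => if u == w then B else setT); split.
    - by move=> u; case: ifP.
    - by move=> u us; case: eqP => // uw; rewrite uw ws in us.
    - rewrite (bigD1 w) //= eqxx big1 ?setIT // => u /negPf ->.
      by rewrite preimage_setT.
  by have := mf measurableT C mC; rewrite setTI.
apply: (@g_sigma_algebra_measure_unique _ _ _ (cylinders s) _ (fun=> setT)).
- move=> _ [B [mB _ ->]]; apply: bigsetI_measurable => w _; exact: mXB.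
- move=> _; exists (fun=> setT); split=> //.
  by rewrite big1 // => w _; rewrite preimage_setT.
- by rewrite bigcup_const //; exists 0.
- move=> _ _ [B [mB B1 ->]] [B' [mB' B1' ->]].
  exists (fun w => B w `&` B' w); split.
  + by move=> w; apply: measurableI.
  + by move=> w ws; rewrite B1 // B1' // setTI.
  + by rewrite -big_split; apply: eq_bigr => w _; rewrite preimage_setI.
- move=> _ [B [mB B1 ->]].
  change (P (\big[setI/setT]_w (X w @^-1` B w) `&` A) =
    (p%:num)%:E * P (\big[setI/setT]_w (X w @^-1` B w)))%E; rewrite pE.
  rewrite indX //.
  pose B' w := if w == v then B0 else B w.
  have -> : \big[setI/setT]_w (X w @^-1` B w) `&` A = \big[setI/setT]_w (X w @^-1` B' w).
    rewrite (bigD1 v) //= [RHS](bigD1 v) //= B1 // preimage_setT setTI setIC.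
    rewrite {1}/B' eqxx; congr (_ `&` _); apply: eq_bigr => w wv.
    by rewrite /B' (negPf wv).
  rewrite indX; last by move=> w; rewrite /B'; case: ifP.
  rewrite (bigD1 v) //= [in RHS](bigD1 v) //= B1 // preimage_setT probability_setT mul1e.
  rewrite {1}/B' eqxx; congr (_ * _)%E; apply: eq_bigr => w wv.
  by rewrite /B' (negPf wv).
- move=> _; change (P (setT `&` A) < +oo)%E; rewrite setTI.
  apply: le_lt_trans (probability_le1 _ _) _ => //.
  exact: ltry.
Qed.

Hypothesis intX : forall v, P.-integrable setT (EFin \o X v).

Lemma independent_family_expectation (s : seq V) : uniq s ->
  P.-integrable setT (fun t => (\prod_(w <- s) X w t)%:E) /\
  (\int[P]_t (\prod_(w <- s) X w t)%:E = \prod_(w <- s) \int[P]_t (X w t)%:E)%E.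
Proof.
elim: s => [_|v s IH /= /andP[vs us]].
  rewrite big_nil (_ : (fun t => _) = cst 1%E); last first.
    by apply/funext => t; rewrite big_nil.
  split; last by rewrite integral_cst // mul1e; exact: probability_setT.
  by apply/(finite_measure_integrable_cst P 1).
have [i1 e1] := IH us.
have mp : measurable_fun setT (fun t => \prod_(w <- s) X w t).
  by apply: measurable_prod => w _.
have [i2 e2] := independent_pair_expectation (mX v) mp (independent_prod vs) (intX v) i1.
rewrite (_ : (fun t => _) = EFin \o (X v \* (fun t => \prod_(w <- s) X w t))).
  by rewrite e2 e1 big_cons.
by apply/funext => t; rewrite big_cons.
Qed.

End IndependentFamily.

(** * Real Gaussian coordinates of a family of GUE matrices *)

(** Groups the coordinates [(k, l)] and [(l, k)], which describe one matrix entry. *)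
Lemma big_lower_triangle (S : Type) (idx : S) (op : Monoid.com_law idx) N
    (F : 'I_N * 'I_N -> S) :
  \big[op/idx]_(kl : 'I_N * 'I_N) F kl =
  \big[op/idx]_(kl : 'I_N * 'I_N | (kl.2 <= kl.1)%N)
     (if kl.1 == kl.2 then F kl else op (F kl) (F (kl.2, kl.1))).
Proof.
rewrite (bigID (fun kl : 'I_N * 'I_N => (kl.2 <= kl.1)%N)) /=.
rewrite [RHS](eq_bigr (fun kl : 'I_N * 'I_N =>
    op (F kl) (if kl.1 == kl.2 then idx else F (kl.2, kl.1)))); last first.
  by move=> kl _; case: eqP => _; rewrite ?Monoid.mulm1.
rewrite big_split /=; congr (op _ _).
rewrite (reindex_inj (h := fun kl : 'I_N * 'I_N => (kl.2, kl.1))) /=; last first.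
  by move=> [? ?] [? ?] [-> ->].
rewrite [RHS](bigID (fun kl : 'I_N * 'I_N => kl.1 == kl.2)) /=.
rewrite [X in _ = op X _]big1 ?Monoid.mul1m; last by move=> kl /andP[_ ->].
apply: eq_big => [[k l]|[k l]] /=; last first.
  by rewrite -ltnNge; case: eqP => // ->; rewrite ltnn.
by rewrite -ltnNge ltn_neqAle -(inj_eq val_inj) eq_sym andbC.
Qed.

Section Coordinates.
Context d (T : measurableType d) (R : realType) (P : probability T R).
Variables (r N : nat).

Local Notation V := ('I_r * ('I_N * 'I_N))%type.

(** For [l < k] the entry [(k, l)] is [(X + i Y) / sqrt 2]; [X] is stored at
    position [(k, l)] and [Y] at position [(l, k)]. This indexes all the
    real Gaussians of the [r] matrices by one type. *)
Definition gue_coord (a : 'I_r -> 'I_N -> 'I_N -> T -> R[i]) (w : V) (t : T) : R :=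
  let: (j, (k, l)) := w in
  if k == l then complex.Re (a j k k t)
  else if (l < k)%N then Num.sqrt 2 * complex.Re (a j k l t)
  else Num.sqrt 2 * complex.Im (a j l k t).

(** Coefficients, in the entry [(k, l)], of the coordinates stored at positions
    [(k, l)] and [(l, k)] (below, [coef_mirror]). *)
Definition coef_own (k l : 'I_N) : R[i] :=
  if k == l then 1 else if (l < k)%N then ((Num.sqrt 2)^-1)%:C%C
  else (0 -i* (Num.sqrt 2)^-1)%C.

Definition coef_mirror (k l : 'I_N) : R[i] :=
  if k == l then 0 else if (l < k)%N then (0 +i* (Num.sqrt 2)^-1)%C
  else ((Num.sqrt 2)^-1)%:C%C.

Definition gue_coef (j : 'I_r) (k l : 'I_N) (w : V) : R[i] :=
  coef_own k l * (w == (j, (k, l)))%:R + coef_mirror k l * (w == (j, (l, k)))%:R.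

Lemma sum_coef (x : V -> R[i]) j k l :
  \sum_w gue_coef j k l w * x w =
  coef_own k l * x (j, (k, l)) + coef_mirror k l * x (j, (l, k)).
Proof.
under eq_bigr do rewrite mulrDl.
rewrite big_split /= (bigD1 (j, (k, l))) //= eqxx mulr1 big1 ?addr0; last first.
  by move=> w /negPf ->; rewrite mulr0 mul0r.
congr (_ + _); rewrite (bigD1 (j, (l, k))) //= eqxx mulr1 big1 ?addr0 //.
by move=> w /negPf ->; rewrite mulr0 mul0r.
Qed.

Let sqrt2_neq0 : Num.sqrt 2 != 0 :> R.
Proof. by rewrite sqrtr_eq0 -ltNge ltr0n. Qed.

Let isqrt2 : (Num.sqrt 2)^-1 * (Num.sqrt 2)^-1 = 2^-1 :> R.
Proof. by rewrite -invfM -expr2 sqr_sqrtr ?ler0n. Qed.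

(** The sum is bilinear, without conjugation: in the off-diagonal case this gives
    covariance 0 for an entry with itself and 1 for an entry with its transpose,
    which is its conjugate. *)
Lemma gue_coef_covariance j k l j' k' l' :
  \sum_w gue_coef j k l w * gue_coef j' k' l' w =
  [&& j == j', k == l' & l == k']%:R.
Proof.
rewrite sum_coef /gue_coef !xpair_eqE.
have [_|_] := eqVneq j j'; last by rewrite !mulr0 !addr0 !mulr0 addr0.
rewrite /=.
have cc : coef_own k l * coef_own k l + coef_mirror k l * coef_mirror k l = (k == l)%:R.
  rewrite /coef_own /coef_mirror; case: eqP => _; first by rewrite mulr1 mulr0 addr0.
  by case: ifP => _; move: isqrt2; move: (Num.sqrt 2)^-1 => s hs;
  apply/eqP; rewrite eq_complex /=; apply/andP; split; apply/eqP; lra.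
have cd : k != l -> coef_own k l * coef_mirror l k + coef_mirror k l * coef_own l k = 1.
  move=> kl; rewrite /coef_own /coef_mirror (negPf kl) eq_sym (negPf kl).
  case: (ltngtP k l) => h.
  - by move: isqrt2; move: (Num.sqrt 2)^-1 => s hs;
    apply/eqP; rewrite eq_complex /=; apply/andP; split; apply/eqP; lra.
  - by move: isqrt2; move: (Num.sqrt 2)^-1 => s hs;
    apply/eqP; rewrite eq_complex /=; apply/andP; split; apply/eqP; lra.
  - by rewrite (val_inj h) eqxx in kl.
set u := (k == k') && (l == l'); set v := (k == l') && (l == k').
rewrite [(l == k') && _]andbC -/v [(l == l') && _]andbC -/u.
have hu : (coef_own k l * coef_own k' l' + coef_mirror k l * coef_mirror k' l') * u%:R =
    (k == l)%:R * u%:R.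
  by rewrite /u; case: eqP => [<-|_]; case: eqP => [<-|_]; rewrite ?mulr0 // cc.
have hv : (coef_own k l * coef_mirror k' l' + coef_mirror k l * coef_own k' l') * v%:R =
    (k != l)%:R * v%:R.
  rewrite /v; case: eqP => [<-|_]; case: eqP => [<-|_]; rewrite ?mulr0 // !mulr1.
  case: (eqVneq k l) cd => [<- _|_ ->] //.
  by rewrite /coef_own /coef_mirror eqxx mulr0 mul0r addr0.
transitivity ((k == l)%:R * u%:R + (k != l)%:R * v%:R : R[i]).
  by rewrite -hu -hv; ring.
rewrite /u /v; case: (eqVneq k l) => [<-|_]; last by rewrite mul0r add0r mul1r.
by rewrite mul0r addr0 mul1r andbC.
Qed.

Variable a : 'I_r -> 'I_N -> 'I_N -> T -> R[i].
Hypothesis a_herm : forall j k l t, a j k l t = conjc (a j l k t).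
Hypothesis a_real : forall j k t, complex.Im (a j k k t) = 0.

Lemma entry_coord j k l t :
  a j k l t = \sum_w gue_coef j k l w * (gue_coord a w t)%:C%C.
Proof.
rewrite sum_coef /= /coef_own /coef_mirror /gue_coord.
rewrite [l == k]eq_sym; case: (eqVneq k l) => [<-|kl].
  rewrite mul1r mul0r addr0; have := a_real j k t.
  by case: (a j k k t) => x y /= ->.
have cK (x : R) : (Num.sqrt 2)^-1 * (Num.sqrt 2 * x) = x by rewrite mulKf.
case: (ltngtP k l) => h.
- by rewrite a_herm; case: (a j l k t) => x y /=; simpc; rewrite !cK.
- by case: (a j k l t) => x y /=; simpc; rewrite !cK.
- by rewrite (val_inj h) eqxx in kl.
Qed.

End Coordinates.

Section SigmaFamily.
Context d (T : measurableType d) (R : realType).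

Lemma sigma_family_preimage d' (T' : measurableType d') (K : Type)
    (Z : K -> T -> T') k (f : T' -> R) (B : set R) :
  measurable_fun setT f -> measurable B -> sigma_family Z ((f \o Z k) @^-1` B).
Proof.
move=> mf mB; apply: sub_sigma_algebra; exists k; exists (f @^-1` B).
  by rewrite -[X in measurable X]setTI; exact: mf.
by rewrite setTI.
Qed.

Lemma sigma_family_bigI d' (T' : measurableType d') (K : Type)
    (Z : K -> T -> T') (I : finType) (D : pred I) (E : I -> set T) :
  (forall i, D i -> sigma_family Z (E i)) ->
  sigma_family Z (\big[setI/setT]_(i | D i) E i).
Proof.
move=> h.
exact: (@bigsetI_measurable _ (g_sigma_algebraType
  [set E | exists k, preimage_set_system setT (Z k) measurable E])).
Qed.

Lemma sigma_familyI d' (T' : measurableType d') (K : Type)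
    (Z : K -> T -> T') (E F : set T) :
  sigma_family Z E -> sigma_family Z F -> sigma_family Z (E `&` F).
Proof.
exact: (@measurableI _ (g_sigma_algebraType
  [set E | exists k, preimage_set_system setT (Z k) measurable E])).
Qed.

End SigmaFamily.

Section GUECoordinates.
Context d (T : measurableType d) (R : realType) (P : probability T R).
Variables (r N : nat) (A : 'I_r -> T -> 'M[R[i]]_N).
Hypothesis N_gt0 : (0 < N)%N.
Variable a : 'I_r -> 'I_N -> 'I_N -> T -> R[i].
Hypothesis A_a : forall j t,
  A j t = ((Num.sqrt N%:R)^-1)%:C%C *: \matrix_(k, l) a j k l t.
Hypothesis a_herm : forall j k l t, a j k l t = conjc (a j l k t).
Hypothesis a_indep : forall j, mutually_independent P
  [set kl : 'I_N * 'I_N | (kl.2 <= kl.1)%N]%SET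
  (fun kl => sigma_family (fun _ : unit => @complex_pair R \o a j kl.1 kl.2)).
Hypothesis a_complex : forall j k l, k != l -> std_complex_gaussian P (a j k l).
Hypothesis a_real : forall j k, std_real_gaussian P (a j k k).
Hypothesis A_indep : independent_matrices P A.

Lemma a_diag_real j k t : complex.Im (a j k k t) = 0.
Proof. by have [X _ ->] := a_real j k. Qed.

Lemma coord_std_normal w :
  exists2 X : {RV P >-> R}, std_normal_RV X & gue_coord a w = X.
Proof.
have s0 : Num.sqrt 2 != 0 :> R by rewrite sqrtr_eq0 -ltNge ltr0n.
case: w => j [k l].
have [<-|kl] := eqVneq k l.
  have [X sX e] := a_real j k; exists X => //.
  by apply/funext => t; rewrite /gue_coord eqxx e.
have split2 (X Y : {RV P >-> R}) (z : T -> R[i]) :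
    (forall t, z t = (X t +i* Y t)%C / (Num.sqrt 2)%:C%C) ->
  (fun t => Num.sqrt 2 * complex.Re (z t)) = X /\
  (fun t => Num.sqrt 2 * complex.Im (z t)) = Y.
  move=> e; split; apply/funext => t; rewrite e -fmorphV; simpc; rewrite /=;
  by rewrite mulrC -mulrA mulVf ?mulr1.
case: (ltngtP k l) => h; last by rewrite (val_inj h) eqxx in kl.
  have lk : l != k by rewrite eq_sym.
  have [X [Y [sX sY _ /split2[_ eY]]]] := a_complex j lk; exists Y => //.
  by apply/funext => t; rewrite /gue_coord (negPf kl) ltnNge (ltnW h) -eY.
have [X [Y [sX sY _ /split2[eX _]]]] := a_complex j kl; exists X => //.
by apply/funext => t; rewrite /gue_coord (negPf kl) h -eX.
Qed.

Lemma coord_pair_indep j (k l : 'I_N) (B B' : set R) : (l < k)%N ->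
  measurable B -> measurable B' ->
  P (gue_coord a (j, (k, l)) @^-1` B `&` gue_coord a (j, (l, k)) @^-1` B') =
  (P (gue_coord a (j, (k, l)) @^-1` B) * P (gue_coord a (j, (l, k)) @^-1` B'))%E.
Proof.
move=> lk mB mB'.
have kl : k != l by apply: contraTneq lk => ->; rewrite ltnn.
have s0 : Num.sqrt 2 != 0 :> R by rewrite sqrtr_eq0 -ltNge ltr0n.
have [X [Y [sX sY ind e]]] := a_complex j kl.
have -> : gue_coord a (j, (k, l)) = X.
  apply/funext => t; rewrite /gue_coord (negPf kl) lk e -fmorphV; simpc => /=.
  by rewrite mulrC -mulrA mulVf ?mulr1.
have -> : gue_coord a (j, (l, k)) = Y.
  apply/funext => t; rewrite /gue_coord eq_sym (negPf kl) ltnNge (ltnW lk) /= e -fmorphV.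
  by simpc => /=; rewrite mulrC -mulrA mulVf ?mulr1.
exact: ind.
Qed.

(** Stated for a multiple [c] of an arbitrary family [Z], in order to serve twice:
    for the sigma-algebra of a single entry, and for that of a whole matrix, whose
    entries are rescaled. *)
Lemma coord_sigma (K : Type) (Z : K -> T -> R * R) (c : R) j (k l : 'I_N) k0 (B : set R) :
  (l <= k)%N -> measurable B ->
  (forall t, complex.Re (a j k l t) = c * (Z k0 t).1) ->
  (forall t, complex.Im (a j k l t) = c * (Z k0 t).2) ->
  sigma_family Z (gue_coord a (j, (k, l)) @^-1` B) /\
  sigma_family Z (gue_coord a (j, (l, k)) @^-1` B).
Proof.
move=> lk mB h1 h2.
have m1 x : measurable_fun setT (fun p : R * R => x * (c * p.1)).
  by do 2 apply: measurable_funM => //; exact: measurable_fst.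
have m2 x : measurable_fun setT (fun p : R * R => x * (c * p.2)).
  by do 2 apply: measurable_funM => //; exact: measurable_snd.
have [e|kl] := eqVneq k l.
  subst l.
  have -> : gue_coord a (j, (k, k)) = (fun p : R * R => 1 * (c * p.1)) \o Z k0.
    by apply/funext => t; rewrite /gue_coord eqxx h1 /= mul1r.
  by split; apply: sigma_family_preimage.
have {}lk : (l < k)%N by rewrite ltn_neqAle lk eq_sym (inj_eq val_inj) kl.
have -> : gue_coord a (j, (k, l)) = (fun p : R * R => Num.sqrt 2 * (c * p.1)) \o Z k0.
  by apply/funext => t; rewrite /gue_coord (negPf kl) lk h1.
have -> : gue_coord a (j, (l, k)) = (fun p : R * R => Num.sqrt 2 * (c * p.2)) \o Z k0.
  by apply/funext => t; rewrite /gue_coord eq_sym (negPf kl) ltnNge (ltnW lk) /= h2.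
by split; apply: sigma_family_preimage.
Qed.

(** Independence holds at three levels: between the matrices, between the entries
    on and below the diagonal of one matrix, and between the two parts of one entry. An
    event on the coordinates is regrouped accordingly, by matrix and by entry. *)
Lemma coord_independent : independent_family P (gue_coord a).
Proof.
move=> B mB.
pose F (w : 'I_r * ('I_N * 'I_N)) := gue_coord a w @^-1` B w.
have -> : \big[setI/setT]_v (gue_coord a v @^-1` B v) =
    \big[setI/setT]_j \big[setI/setT]_kl F (j, kl).
  by rewrite pair_bigA; apply: eq_bigr => -[].
have -> : (\prod_v P (gue_coord a v @^-1` B v) = \prod_j \prod_kl P (F (j, kl)))%E.
  by rewrite pair_bigA; apply: eq_bigr => -[].
under eq_bigr do rewrite big_lower_triangle.
pose D := [set kl : 'I_N * 'I_N | (kl.2 <= kl.1)%N]%SET.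
pose E j (kl : 'I_N * 'I_N) := if kl.1 == kl.2 then F (j, kl)
  else F (j, kl) `&` F (j, (kl.2, kl.1)).
have sN0 : Num.sqrt N%:R != 0 :> R by rewrite sqrtr_eq0 -ltNge ltr0n.
have aRe j k l t : complex.Re (a j k l t) = Num.sqrt N%:R * complex.Re (A j t k l).
  by rewrite A_a !mxE; case: (a j k l t) => x y; simpc => /=; rewrite mulVKf.
have aIm j k l t : complex.Im (a j k l t) = Num.sqrt N%:R * complex.Im (A j t k l).
  by rewrite A_a !mxE; case: (a j k l t) => x y; simpc => /=; rewrite mulVKf.
pose Z1 j (kl : 'I_N * 'I_N) (t : T) := complex_pair (A j t kl.1 kl.2).
pose Z2 j k l (_ : unit) (t : T) := complex_pair (a j k l t).
have EA j (kl : 'I_N * 'I_N) : (kl.2 <= kl.1)%N -> sigma_family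
    (fun (kl : 'I_N * 'I_N) (t : T) => complex_pair (A j t kl.1 kl.2)) (E j kl).
  case: kl => k l /= lk.
  have [h1 _] := coord_sigma (Z := Z1 j) (k0 := (k, l)) lk (mB (j, (k, l)))
    (aRe j k l) (aIm j k l).
  have [_ h2] := coord_sigma (Z := Z1 j) (k0 := (k, l)) lk (mB (j, (l, k)))
    (aRe j k l) (aIm j k l).
  by rewrite /E /=; case: eqP => _ //; apply: sigma_familyI.
have Ea j (kl : 'I_N * 'I_N) : (kl.2 <= kl.1)%N -> sigma_family
    (fun _ : unit => @complex_pair R \o a j kl.1 kl.2) (E j kl).
  case: kl => k l /= lk.
  have m1 t : complex.Re (a j k l t) = 1 * (complex_pair (a j k l t)).1 by rewrite mul1r.
  have m2 t : complex.Im (a j k l t) = 1 * (complex_pair (a j k l t)).2 by rewrite mul1r.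
  have [h1 _] := coord_sigma (Z := Z2 j k l) (k0 := tt) lk (mB (j, (k, l))) m1 m2.
  have [_ h2] := coord_sigma (Z := Z2 j k l) (k0 := tt) lk (mB (j, (l, k))) m1 m2.
  by rewrite /E /=; case: eqP => _ //; apply: sigma_familyI.
have := A_indep (subxx [set: 'I_r]%SET)
  (E := fun j => \big[setI/setT]_(kl : 'I_N * 'I_N | (kl.2 <= kl.1)%N) E j kl).
have inT (S : Type) (idx : S) op (G : 'I_r -> S) :
    \big[op/idx]_(j in [set: 'I_r]%SET) G j = \big[op/idx]_j G j.
  by apply: eq_bigl => j; rewrite finset.inE.
have inD (S : Type) (idx : S) op (G : 'I_N * 'I_N -> S) :
    \big[op/idx]_(kl in D) G kl = \big[op/idx]_(kl : 'I_N * 'I_N | (kl.2 <= kl.1)%N) G kl.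
  by apply: eq_bigl => kl; rewrite finset.inE.
rewrite !inT => -> => [|j _]; last by apply: sigma_family_bigI => kl; exact: EA.
apply: eq_bigr => j _.
rewrite big_lower_triangle.
have := a_indep (j := j) (subxx D) (E := E j).
rewrite !inD => -> => [|kl]; last by rewrite finset.inE; exact: Ea.
apply: eq_bigr => -[k l] /= lk; rewrite /E /=; case: (eqVneq k l) => // kl.
by rewrite coord_pair_indep // ltn_neqAle lk eq_sym (inj_eq val_inj) kl.
Qed.

End GUECoordinates.

(** * Traces of products and expectations of polynomials *)

Section TupleSums.
Variables (C : comPzRingType) (S : finType).

Lemma sum_tuple_cons n (F : n.+1.-tuple S -> C) :
  \sum_s F s = \sum_(z : S) \sum_(s : n.-tuple S) F [tuple of z :: s].
Proof.
rewrite pair_bigA /= (reindex (fun p : S * n.-tuple S => [tuple of p.1 :: p.2])) //.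
exists (fun s => (thead s, [tuple of behead s])) => [[z s] _|s _] /=.
  by congr (_, _); apply: val_inj.
by rewrite [RHS](tuple_eta s); apply: val_inj.
Qed.

End TupleSums.

Section MatrixProducts.
Variables (C : comPzRingType) (N : nat).

(** Sum over the paths from [x] to [y] with [n] intermediate vertices [s]; the
    default value of [nth] supplies the last vertex [y]. *)
Lemma mulmx_prod_entry n (M : 'I_n.+1 -> 'M[C]_N) x y :
  (\prod_(k < n.+1) M k) x y =
  \sum_(s : n.-tuple 'I_N) \prod_(k < n.+1) M k (nth y (x :: s) k) (nth y (x :: s) k.+1).
Proof.
elim: n M x => [|n IH] M x.
  rewrite big_ord_recl big_ord0 mulr1 (big_pred1 [tuple]) => [|s]; last first.
    by rewrite [s]tuple0; apply/esym/eqP.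
  by rewrite big_ord_recl big_ord0 mulr1.
rewrite big_ord_recl mxE sum_tuple_cons; apply: eq_bigr => z _.
rewrite IH big_distrr; apply: eq_bigr => s _.
by rewrite [RHS]big_ord_recl.
Qed.

Lemma mxtrace_prod m (m_gt0 : (0 < m)%N) (M : 'I_m -> 'M[C]_N) :
  \tr (\prod_(k < m) M k) =
  \sum_(f : {ffun 'I_m -> 'I_N}) \prod_(k < m) M k (f k) (f (cyc_shift m k)).
Proof.
case: m m_gt0 M => // n _ M.
transitivity (\sum_(u : n.+1.-tuple 'I_N)
    \prod_(k < n.+1) M k (tnth u k) (tnth u (cyc_shift n.+1 k))).
  rewrite /mxtrace sum_tuple_cons; apply: eq_bigr => x _.
  rewrite mulmx_prod_entry; apply: eq_bigr => s _; apply: eq_bigr => k _.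
  rewrite !(tnth_nth x) permE; congr (M k _ _).
  have := ltn_ord k; rewrite ltnS leq_eqVlt => /orP[/eqP e|lt].
    by rewrite /= e modnn nth_default //= size_tuple.
  by rewrite /= modn_small.
rewrite (reindex (fun f : {ffun 'I_n.+1 -> 'I_N} => [tuple f k | k < n.+1])) /=.
  by apply: eq_bigr => f _; apply: eq_bigr => k _; rewrite !tnth_mktuple.
exists (fun u => [ffun k => tnth u k]) => [f _|u _].
  by apply/ffunP => k; rewrite ffunE tnth_mktuple.
by apply: eq_from_tnth => k; rewrite tnth_mktuple ffunE.
Qed.

End MatrixProducts.

Section ComplexExpectation.
Context d (T : measurableType d) (R : realType) (P : probability T R).

(** Finite sums of complex multiples of real random variables are all that is
    needed, as the trace is a polynomial in the real coordinates. *)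
Lemma complex_expectation_sum (I : finType) (c : I -> R[i]) (Y : I -> T -> R) :
  (forall i, P.-integrable setT (EFin \o Y i)) ->
  complex_integrable P (fun t => \sum_i c i * (Y i t)%:C%C) /\
  complex_expectation P (fun t => \sum_i c i * (Y i t)%:C%C) =
  \sum_i c i * (fine (\int[P]_t (Y i t)%:E))%:C%C.
Proof.
move=> iY.
have real_sum (b : I -> R) :
    P.-integrable setT (EFin \o (fun t => \sum_i b i * Y i t)) /\
    (fine 'E_P[fun t => \sum_i b i * Y i t] = \sum_i b i * fine (\int[P]_t (Y i t)%:E)).
  have ibY i : P.-integrable setT (fun t => (b i)%:E * (Y i t)%:E)%E.
    exact: integrableZl (iY i).
  have e : EFin \o (fun t => \sum_i b i * Y i t) =
      (fun t => \sum_i (b i)%:E * (Y i t)%:E)%E.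
    apply/funext => t /=; rewrite -sumEFin; apply: eq_bigr => i _.
    by rewrite EFinM.
  split.
    rewrite e; apply: (@integrable_sum _ _ _ P setT measurableT) => i _ //.
  rewrite unlock.
  have -> : (\int[P]_t (\sum_i b i * Y i t)%:E = \sum_i (b i)%:E * \int[P]_t (Y i t)%:E)%E.
    transitivity (\int[P]_t (\sum_i (b i)%:E * (Y i t)%:E))%E.
      by apply: eq_integral => t _; rewrite -[RHS](congr1 (fun f => f t) e).
    rewrite integral_sum //; apply: eq_bigr => i _.
    exact: integralZl (iY i) _.
  have fY i : (\int[P]_t (Y i t)%:E)%E \is a fin_num := integrable_fin_num measurableT (iY i).
  rewrite -sum_fine => [|i _]; last by rewrite fin_numM.
  by apply: eq_bigr => i _; rewrite fineM.
have reE : (fun t => complex.Re (\sum_i c i * (Y i t)%:C%C)) =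
    (fun t => \sum_i complex.Re (c i) * Y i t).
  apply/funext => t; rewrite (raddf_sum (@complex.Re R : Rcomplex R -> R)).
  by apply: eq_bigr => i _; case: (c i) => u v /=; rewrite mulr0 subr0.
have imE : (fun t => complex.Im (\sum_i c i * (Y i t)%:C%C)) =
    (fun t => \sum_i complex.Im (c i) * Y i t).
  apply/funext => t; rewrite (raddf_sum (@complex.Im R : Rcomplex R -> R)).
  by apply: eq_bigr => i _; case: (c i) => u v /=; rewrite mulr0 add0r.
rewrite /complex_integrable /complex_expectation.
have [iRe eRe] := real_sum (fun i => complex.Re (c i)).
have [iIm eIm] := real_sum (fun i => complex.Im (c i)).
rewrite reE imE; split; first by split.
rewrite eRe eIm; apply/eqP; rewrite eq_complex /=; apply/andP; split; apply/eqP.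
  rewrite (raddf_sum (@complex.Re R : Rcomplex R -> R)); apply: eq_bigr => i _.
  by case: (c i) => u v /=; rewrite mulr0 subr0.
rewrite (raddf_sum (@complex.Im R : Rcomplex R -> R)); apply: eq_bigr => i _.
by case: (c i) => u v /=; rewrite mulr0 add0r.
Qed.

End ComplexExpectation.

Section MonomialExpectation.
Context d (T : measurableType d) (R : realType) (P : probability T R).

Lemma std_normal_RV_moment (X : {RV P >-> R}) n : std_normal_RV X ->
  P.-integrable setT (fun t => (X t ^+ n)%:E) /\
  (\int[P]_t (X t ^+ n)%:E = (normal_moment R n)%:E)%E.
Proof.
move=> sX.
have mX : measurable_fun [set: R] (fun x : R => (x ^+ n)%:E).
  by apply/measurable_EFinP; exact: measurable_funX.
have iX := integrable_std_normal_power R n.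
(* [X] as a map into the measurable structure that carries the normal law *)
have mX' : measurable_fun setT (X : T -> measurableTypeR R).
  by move=> _ B mB; exact: (measurable_funP X measurableT).
pose X' : {mfun T >-> measurableTypeR R} :=
  HB.pack (X : T -> measurableTypeR R) (isMeasurableFun.Build _ _ _ _ _ mX').
have law (f : measurableTypeR R -> \bar R) :
    (\int[distribution P X']_x f x = \int[normal_prob 0 1]_x f x)%E.
  by apply: eq_measure_integral => B mB _; exact: sX.
have iP : P.-integrable setT (fun t => (X t ^+ n)%:E).
  apply/integrableP; split.
    apply/measurable_EFinP; apply: measurable_funX; exact: measurable_funP.
  have /integrableP[_] := iX; rewrite -law (ge0_integral_distribution X') //.
  exact: measurableT_comp.
split=> //; rewrite -(integral_distribution (X := X') mX iP) law /normal_moment fineK //.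
exact: integrable_fin_num.
Qed.

Variables (V : finType) (g : V -> T -> R).
Hypothesis g_normal : forall w, exists2 X : {RV P >-> R}, std_normal_RV X & g w = X.
Hypothesis g_indep : independent_family P g.

(** Collecting equal factors, the monomial is a product over [w] of powers of the
    independent [g w]. *)
Lemma normal_monomial_expectation (I : finType) (v : I -> V) :
  P.-integrable setT (EFin \o (fun t => \prod_p g (v p) t)) /\
  fine (\int[P]_t (\prod_p g (v p) t)%:E)%E =
  \prod_(w : V) normal_moment R #|[set p | v p == w]%SET|.
Proof.
pose e w := #|[set p | v p == w]%SET|.
pose X w t := g w t ^+ e w.
have prodX t : \prod_p g (v p) t = \prod_w X w t.
  rewrite (partition_big v predT) //=; apply: eq_bigr => w _.
  rewrite (eq_bigr (fun=> g w t)) => [|p /eqP -> //].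
  by rewrite prodr_const; congr (_ ^+ _); apply: eq_card => p; rewrite finset.inE.
have mg w : measurable_fun setT (g w).
  by have [Y _ ->] := g_normal w; exact: measurable_funP.
have mX w : measurable_fun setT (X w) by exact: measurable_funX.
have iX w : P.-integrable setT (EFin \o X w).
  rewrite /X; have [Y sY ->] := g_normal w.
  by have [] := std_normal_RV_moment (e w) sY.
have eX w : (\int[P]_t (X w t)%:E = (normal_moment R (e w))%:E)%E.
  rewrite /X; have [Y sY ->] := g_normal w.
  by have [] := std_normal_RV_moment (e w) sY.
have indX : independent_family P X.
  move=> B mB; apply: (g_indep (B := fun w => (fun x => x ^+ e w) @^-1` B w)) => w.
  rewrite -[X in measurable X]setTI.
  exact: (@measurable_funX _ _ _ setT (fun x : R => x) (e w)).
have [i1 e1] := independent_family_expectation mX indX iX (index_enum_uniq V).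
rewrite (_ : (fun t => \prod_p g (v p) t) = (fun t => \prod_w X w t)); last exact/funext.
split=> //.
under eq_integral do rewrite prodX.
rewrite e1 (eq_bigr (fun w => (normal_moment R (e w))%:E)) => [|w _]; last exact: eX.
by rewrite -(big_morph EFin EFinM erefl).
Qed.

End MonomialExpectation.

(** * Expectation of the trace *)

Section PairCovariance.
Variables (m r N : nat) (R : realType).
Variable i : 'I_m -> 'I_r.

(** For a block [{p, q}] of [pi] the covariance asks for [f p = f (gamma q)] and
    [f q = f (gamma p)], with [q = pi p]: this is invariance of [f] under gamma pi
    at [p] and [q]. *)
Lemma prod_pair_covariance (f : {ffun 'I_m -> 'I_N}) (pi : {set {set 'I_m}}) :
  pi \in pairings m ->
  \prod_(B in pi) (\sum_w \prod_(p in B)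
     gue_coef R (i p) (f p) (f (cyc_shift m p)) w) =
  (respects i pi && [forall p, f ((pairing_perm pi * cyc_shift m)%g p) == f p])%:R.
Proof.
move=> pip; have pp : pi \in pair_partitions [set: 'I_m]%SET by [].
have /pair_partitionsP[cov tI c2] := pp.
have covB p q : q != p -> \sum_w \prod_(s in [set p; q]%SET)
     gue_coef R (i s) (f s) (f (cyc_shift m s)) w =
   [&& i p == i q, f p == f (cyc_shift m q) & f (cyc_shift m p) == f q]%:R.
  move=> qp; rewrite -gue_coef_covariance; apply: eq_bigr => w _.
  by rewrite big_setU1 ?finset.inE 1?eq_sym //= big_set1.
have ppE p q : [set p; q]%SET \in pi -> pairing_perm pi p = q by exact: pairing_permP.
have [/andP[/forallP ri /forallP fx]|] := boolP (_ && _).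
  rewrite big1 // => B Bpi.
  have /cards2P[p [q [npq eB]]] : #|B| == 2 by rewrite c2.
  have qp : q != p by rewrite eq_sym.
  rewrite eB in Bpi *; rewrite covB //.
  have /forallP/(_ q)/implyP/(_ Bpi) -> := ri p.
  have := fx p; rewrite permM (ppE p q Bpi) => /eqP ->.
  have Bpi' := Bpi; rewrite finset.setUC in Bpi'.
  by have := fx q; rewrite permM (ppE q p Bpi') => /eqP ->; rewrite !eqxx.
rewrite negb_and => /orP[].
  rewrite negb_forall => /existsP[p]; rewrite negb_forall => /existsP[q].
  rewrite negb_imply => /andP[Bpi ipq].
  have qp : q != p by apply: contraNneq ipq => ->.
  by rewrite (bigD1 _ Bpi) /= covB // (negPf ipq) mul0r.
rewrite negb_forall => /existsP[p]; rewrite permM => fp.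
have [qp Bpi] := mate_pair pp (finset.in_setT p).
rewrite (ppE p _ Bpi) in fp.
by rewrite (bigD1 _ Bpi) /= covB // [f p == _]eq_sym (negPf fp) /= andbF mul0r.
Qed.

End PairCovariance.

Lemma pairings_respE m r (i : 'I_m -> 'I_r) (pi : {set {set 'I_m}}) :
  (pi \in pairings_resp i) = (pi \in pairings m) && respects i pi.
Proof. by rewrite [LHS]finset.inE. Qed.

Section Assembly.
Context d (T : measurableType d) (R : realType) (P : probability T R).
Variables (r N : nat) (A : 'I_r -> T -> 'M[R[i]]_N).
Hypothesis N_gt0 : (0 < N)%N.
Hypothesis A_GUE : forall j, is_GUE P (A j).
Hypothesis A_indep : independent_matrices P A.
Variables (m : nat) (i : 'I_m -> 'I_r).
Hypothesis m_gt0 : (0 < m)%N.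

Let K : R[i] := N%:R^-1 * ((Num.sqrt N%:R)^-1)%:C%C ^+ m.

Lemma gue_trace_expectation :
  complex_integrable P (fun t => normalized_trace (\prod_(k < m) A (i k) t)) /\
  complex_expectation P (fun t => normalized_trace (\prod_(k < m) A (i k) t)) =
  K * \sum_(pi in pairings_resp i) (N ^ ncycles_gamma pi)%:R.
Proof.
have [a ha] := choice A_GUE.
have A_a j t : A j t = ((Num.sqrt N%:R)^-1)%:C%C *: \matrix_(k, l) a j k l t.
  by have [] := ha j.
have a_herm j k l t : a j k l t = conjc (a j l k t) by have [] := ha j.
have a_indep j : mutually_independent P
  [set kl : 'I_N * 'I_N | (kl.2 <= kl.1)%N]%SET
  (fun kl => sigma_family (fun _ : unit => @complex_pair R \o a j kl.1 kl.2)).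
  by have [] := ha j.
have a_complex j k l : k != l -> std_complex_gaussian P (a j k l).
  by have [_ _ _ + _] := ha j; apply.
have a_real j k : std_real_gaussian P (a j k k) by have [_ _ _ _ +] := ha j; apply.
have g_ind := coord_independent N_gt0 A_a a_indep a_complex A_indep.
have g_norm := coord_std_normal a_complex a_real.
pose g := gue_coord a.
pose c (f : {ffun 'I_m -> 'I_N}) (p : 'I_m) := gue_coef R (i p) (f p) (f (cyc_shift m p)).
pose v0 : 'I_r * ('I_N * 'I_N) := (i (Ordinal m_gt0), (Ordinal N_gt0, Ordinal N_gt0)).
pose J := ({ffun 'I_m -> 'I_N} * {ffun 'I_m -> 'I_r * ('I_N * 'I_N)})%type.
have traceE : (fun t => normalized_trace (\prod_(k < m) A (i k) t)) =
  (fun t => \sum_(q : J) (K * \prod_p c q.1 p (q.2 p)) * (\prod_p g (q.2 p) t)%:C%C).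
  apply/funext => t; rewrite /normalized_trace mxtrace_prod //.
  transitivity (\sum_f \sum_(v : {ffun 'I_m -> 'I_r * ('I_N * 'I_N)})
      (K * \prod_p c f p (v p)) * (\prod_p g (v p) t)%:C%C); last by rewrite pair_bigA.
  rewrite big_distrr /=; apply: eq_bigr => f _.
  under eq_bigr => p _.
    rewrite A_a !mxE (entry_coord a_herm (a_diag_real a_real)) big_distrr /=.
    over.
  rewrite bigA_distr_bigA /= big_distrr /=; apply: eq_bigr => v _.
  rewrite !big_split /= prodr_const card_ord !mulrA; congr (_ * _).
  by rewrite rmorph_prod.
rewrite traceE.
have mono (v : {ffun 'I_m -> 'I_r * ('I_N * 'I_N)}) :=
  normal_monomial_expectation g_norm g_ind v.
have [iS ->] := complex_expectation_sum (fun q : J => K * \prod_p c q.1 p (q.2 p))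
  (fun q : J => (mono q.2).1).
split=> //.
transitivity (\sum_f \sum_(v : {ffun 'I_m -> 'I_r * ('I_N * 'I_N)})
    (K * \prod_p c f p (v p)) * (fine (\int[P]_t (\prod_p g (v p) t)%:E))%:C%C).
  by rewrite pair_bigA.
transitivity (K * \sum_(f : {ffun 'I_m -> 'I_N}) \sum_(v : {ffun 'I_m -> 'I_r * ('I_N * 'I_N)})
    (\prod_p c f p (v p)) *
      \prod_w (normal_moment R #|[set p | v p == w]%SET|)%:C%C).
  rewrite big_distrr; apply: eq_bigr => f _; rewrite big_distrr; apply: eq_bigr => v _.
  by rewrite (mono v).2 rmorph_prod -mulrA.
congr (K * _).
under eq_bigr => f _.
  rewrite (@wick_linear_forms _ _ _ (fun n => (normal_moment R n)%:C%C) v0 (c f)); last 3 first.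
  - by rewrite normal_moment0.
  - by rewrite normal_moment1.
  - by move=> n; rewrite normal_moment_rec rmorphM rmorph_nat.
  rewrite (eq_bigr (fun pi => (respects i pi)%:R *
     ([forall p, f ((pairing_perm pi * cyc_shift m)%g p) == f p])%:R)); last first.
    by move=> pi pip; rewrite prod_pair_covariance // -mulnb natrM.
  over.
rewrite exchange_big /= [RHS]big_mkcond [LHS]big_mkcond /=; apply: eq_bigr => pi _.
rewrite pairings_respE -pairingsE; case: ifP => // _.
rewrite -big_distrr /= (sum_fixed_functions (Ordinal N_gt0)) card_ord.
by case: (respects i pi); rewrite ?mul1r ?mul0r.
Qed.

End Assembly.

(** * Limit for large matrices *)

Section Limit.
Variable R : realType.

Lemma powR_pairing (N m : nat) (pi : {set {set 'I_m}}) : (0 < N)%N ->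
  pi \in pairings m ->
  (N%:R : R) `^ ((ncycles_gamma pi)%:R - m%:R / 2 - 1) =
  N%:R^-1 * (Num.sqrt N%:R)^-1 ^+ m * N%:R ^+ ncycles_gamma pi.
Proof.
move=> N0 pip; have N0' : (N%:R : R) != 0 by rewrite pnatr_eq0 -lt0n.
have em := card_pairing pip.
rewrite [in m%:R]em -mul2n natrM mulrAC divff ?pnatr_eq0 // mul1r.
have -> : (Num.sqrt N%:R)^-1 ^+ m = N%:R^-1 ^+ #|pi| :> R.
  have h2 : (Num.sqrt N%:R)^-1 ^+ 2 = N%:R^-1 :> R by rewrite exprVn sqr_sqrtr ?ler0n.
  by rewrite [X in _ ^+ X = _]em -mul2n exprM h2.
rewrite -addrA powRD ?N0' ?implybT // -opprD powRN powRD ?N0' ?implybT //.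
by rewrite !powR_mulrn ?ler0n // powRr1 ?ler0n // invfM exprVn mulrC [_^-1 * _^-1]mulrC.
Qed.

(** By the genus bound the exponent is 0 for a non-crossing pairing and at most -1
    for any other one. *)
Lemma cvg_powR_pairing m (pi : {set {set 'I_m}}) : (0 < m)%N -> pi \in pairings m ->
  (fun N : nat => (N%:R : R) `^ ((ncycles_gamma pi)%:R - m%:R / 2 - 1)) @ \oo -->
  ((noncrossing pi)%:R : R).
Proof.
move=> m0 pip; have em := card_pairing pip.
have -> : m%:R / 2 = #|pi|%:R :> R.
  by rewrite [in m%:R]em -mul2n natrM mulrAC divff ?pnatr_eq0 // mul1r.
rewrite -(ncycles_gamma_noncrossing m0 pip).
have := ncycles_gamma_ub m0 pip; rewrite leq_eqVlt => /orP[/eqP ->|lt].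
  rewrite eqxx; apply: cvg_near_cst; near=> N.
  by rewrite -natr1 addrAC addrK subrr powRr0.
rewrite ltn_eqF //.
apply: (@squeeze_cvgr _ _ _ _ (fun=> 0) (fun N => (N%:R)^-1)).
- near=> N; rewrite powR_ge0 /=.
  have N1 : 1 <= N%:R :> R by rewrite ler1n; near: N; exact: nbhs_infty_gt.
  rewrite -[leRHS]powR_inv1 ?(le_trans ler01) // ler_powR //.
  by rewrite lerBlDr addNr subr_le0 ler_nat.
- exact: cvg_cst.
- apply: ((gtr0_cvgV0 _).2 (@cvgr_idn R)).
  by near=> N; rewrite ltr0n; near: N; exact: nbhs_infty_gt.
Unshelve. all: end_near.
Qed.

End Limit.

Lemma sum_noncrossing (R : realType) r m (i : 'I_m -> 'I_r) :
  \sum_(pi in pairings_resp i) (noncrossing pi)%:R = #|nc_pairings_resp i|%:R :> R.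
Proof.
rewrite -sum1_card natr_sum [RHS]big_mkcond [LHS]big_mkcond /=.
apply: eq_bigr => pi _; rewrite [in RHS]finset.inE.
by case: (pi \in pairings_resp i); case: (noncrossing pi).
Qed.

Lemma cvg_real_complex (R : realType) (u : nat -> R) (l : R) :
  u @ \oo --> l -> (fun n => (u n)%:C%C : R[i]^o) @ \oo --> (l%:C%C : R[i]^o).
Proof.
move=> ul; apply/cvgrPdist_lt => e e0.
have [e1 e2] : 0 < complex.Re e /\ e = (complex.Re e)%:C%C.
  by case: e e0 => x y; rewrite ltcE /= => /andP[/eqP -> ->].
have /cvgrPdist_lt /(_ _ e1) := ul.
apply: filterS => n h.
rewrite e2 -rmorphB /= normc_def /= expr0n addr0 sqrtr_sqr ltcR.
exact: h.
Qed.

Theorem theorem12p3 (R : realType) (r : nat)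
    (d : nat -> measure_display)
    (T : forall N : nat, measurableType (d N))
    (P : forall N : nat, probability (T N) R)
    (A : forall N : nat, 'I_r -> T N -> 'M[R[i]]_N)
    (A_GUE : forall N : nat, (0 < N)%N ->
      forall j : 'I_r, is_GUE (P N) (A N j))
    (A_indep : forall N : nat, (0 < N)%N -> independent_matrices (P N) (A N))
    (m : nat) (m_gt0 : (0 < m)%N) (i : 'I_m -> 'I_r) :
  (forall N : nat, (0 < N)%N ->
     complex_integrable (P N)
       (fun t => normalized_trace (\prod_(k < m) A N (i k) t)) /\
     complex_expectation (P N)
       (fun t => normalized_trace (\prod_(k < m) A N (i k) t)) =
     (\sum_(pi in pairings_resp i)
        N%:R `^ ((ncycles_gamma pi)%:R - m%:R / 2 - 1))%:C%C)
  /\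
  (fun N : nat => complex_expectation (P N)
     (fun t => normalized_trace (\prod_(k < m) A N (i k) t)))
    @ \oo --> (#|nc_pairings_resp i|%:R : R[i]^o).
Proof.
have resp_pairing pi : pi \in pairings_resp i -> pi \in pairings m.
  by rewrite pairings_respE => /andP[].
have formula N (N0 : (0 < N)%N) : complex_integrable (P N)
       (fun t => normalized_trace (\prod_(k < m) A N (i k) t)) /\
     complex_expectation (P N)
       (fun t => normalized_trace (\prod_(k < m) A N (i k) t)) =
     (\sum_(pi in pairings_resp i)
        N%:R `^ ((ncycles_gamma pi)%:R - m%:R / 2 - 1))%:C%C.
  have [int ->] := gue_trace_expectation N0 (A_GUE N N0) (A_indep N N0) i m_gt0.
  split=> //; rewrite big_distrr rmorph_sum /=; apply: eq_bigr => pi /resp_pairing pip.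
  by rewrite natrX powR_pairing // !rmorphM !rmorphXn [X in _ = X * _ * _]fmorphV !rmorph_nat.
split=> //.
have lim : (fun N => \sum_(pi in pairings_resp i)
        (N%:R : R) `^ ((ncycles_gamma pi)%:R - m%:R / 2 - 1)) @ \oo -->
      (#|nc_pairings_resp i|%:R : R).
  rewrite -sum_noncrossing.
  apply: cvg_big => [|pi /resp_pairing pip]; first exact: add_continuous.
  exact: cvg_powR_pairing.
have := cvg_real_complex lim; rewrite rmorph_nat; apply: cvg_trans.
apply: near_eq_cvg; near=> N.
have N0 : (0 < N)%N by near: N; exact: nbhs_infty_gt.
by have [_ ->] := formula N N0.
Unshelve. all: end_near.
Qed.
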